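(* Let $\mathbb B$ be a stochastic set of interval type, $H\in\mathcal P^{\mathbb B}$ and $A\in\mathcal V^{\mathbb B}$. The following assertions are equivalent: (A1) $H\in\mathcal L_s^{\mathbb B}(A)$. (A2) There exist a coupled predictable process $\widetilde H$ for $H\in\mathcal P^{\mathbb B}$ and an FCS $(T_n,A^{(n)})$ for $A\in\mathcal V^{\mathbb B}$ such that $\widetilde H\in\mathcal L_s(A^{(n)})$ for each $n\in\mathbf N^+$. (A3) There exist FCSs $(T_n,H^{(n)})$ for $H\in\mathcal P^{\mathbb B}$ and $(T_n,A^{(n)})$ for $A\in\mathcal V^{\mathbb B}$ such that $H^{(n)}\in\mathcal L_s(A^{(n)})$ for each $n\in\mathbf N^+$.
   Context: Fix a probability space $(\Omega,\mathcal F,\mathbf P)$ with a filtration $\mathbb F=(\mathcal F_t)_{t\ge0}$ satisfying the usual conditions; $\mathbf R^+=[0,+\infty[$, $\mathbf N^+=\{1,2,\dots\}$. Indistinguishable processes are identified. $[\![S,T]\!]=\{(\omega,t)\in\Omega\times\mathbf R^+:S(\omega)\le t\le T(\omega)\}$, and $[\![S,T[\![$, $]\!]S,T]\!]$ are defined analogously. $X^T$ is $X$ stopped at $T$. For sets, $AB=A\cap B$. For $C\subseteq\Omega\times\mathbf R^+$ and a real function $X$ on $\widetilde C\subseteq\Omega\times\mathbf R^+$, $XI_C$ equals $X$ on $C\cap\widetilde C$ and $0$ elsewhere. A stochastic set of interval type $\mathbb B$ is an optional (or predictable) subset of $\Omega\times\mathbf R^+$ such that for some nonnegative random variable $T$ each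 section $\mathbb B_\omega=\{t:(\omega,t)\in\mathbb B\}$ is nonempty and equal to $[0,T(\omega)[$ or $[0,T(\omega)]$. Here $T$ (the debut of $\mathbb B^c$) is a stopping time. For a class $\mathcal D$ of processes, $\mathcal D^{\mathbb B}$ is the set of real functions $X$ on $\mathbb B$ for which there exist an increasing sequence of stopping times $T_n\uparrow T$ with $\bigcup_n[\![0,T_n]\!]\supseteq\mathbb B$ and $X^{(n)}\in\mathcal D$ with $(XI_{\mathbb B})^{T_n}=(X^{(n)}I_{\mathbb B})^{T_n}$ for all $n$ (equivalently $XI_{\mathbb B[\![0,T_n]\!]}=X^{(n)}I_{\mathbb B[\![0,T_n]\!]}$). Then $(T_n,X^{(n)})$ is called an FCS (fundamental coupled sequence) for $X\in\mathcal D^{\mathbb B}$. $X=Y$ for functions on $\mathbb B$ means $XI_{\mathbb B}$ and $YI_{\mathbb B}$ are indistinguishable. $Y\mathfrak I_{\mathbb B}$ denotes the restriction of $Y$ to $\mathbb B$. $\mathcal P$: predictable processes; $\mathcal V$: adapted (càdlàg) processes with finite variation. A coupled predictable process for $H\in\mathcal P^{\mathbb B}$ is a predictable process $\widetilde H$ with $H=\widetilde H\mathfrak I_{\mathbb B}$. Classical Stieltjes integral: for $A\in\mathcal V$, $\mathcal L_s(A)$ is the class of predictable $H$ with $\int_{[0,t]}|H_s||dA_s|<+\infty$ for all $t$; $(H.A)_t=\int_{[0,t]}H_s\,dA_s$, which includes the time-$0$ term $H_0A_0$. $\mathbb B$-Stieltjes integral: $H\in\mathcal P^{\mathbb B}$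 is $\mathbb B$-integrable with respect to $A\in\mathcal V^{\mathbb B}$, written $H\in\mathcal L_s^{\mathbb B}(A)$, if (1) $\int_{[0,t]}|H_s(\omega)||dA_s(\omega)|<+\infty$ for all $(\omega,t)\in\mathbb B$; and (2) the function $L(\omega,t)=\int_{[0,t]}H_s(\omega)\,dA_s(\omega)$, $(\omega,t)\in\mathbb B$, belongs to $\mathcal V^{\mathbb B}$. Then $H_\bullet A:=L$. *)

(* Defs.v *)
From HB Require Import structures.
From mathcomp Require Import all_boot all_order all_algebra.
From mathcomp Require Import all_classical all_reals all_analysis.
From mathcomp Require Import measurable_realfun.

Set Implicit Arguments.
Unset Strict Implicit.
Unset Printing Implicit Defensive.

Import Order.TTheory GRing.Theory Num.Theory.
Import numFieldNormedType.Exports.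

Local Open Scope classical_set_scope.
Local Open Scope ring_scope.

(* Time is [0, +oo[ inside R: a path is a function R -> R and a process a
   function Om * R -> R, of which only the values at times t >= 0 matter. *)

Section paths.
Context {R : realType}.
Implicit Types (a h g : R -> R) (t : R).

Definition cadlag a : Prop := forall t : R, 0 <= t ->
  (a x @[x --> t^'+] --> a t) /\ (0 < t -> cvg (a x @[x --> t^'-])).

Definition left_continuous_path a : Prop := forall t : R, 0 < t ->
  a x @[x --> t^'-] --> a t.

Definition finite_variation a : Prop := forall t : R, 0 <= t ->
  bounded_variation 0 t a.

(* The Stieltjes measure of g, when g is nondecreasing and right-continuous;
   the Lebesgue measure otherwise. *)
Definition to_cumulative g : cumulative R R :=
  match pselect ({homo g : x y / x <= y} /\ right_continuous g) with
  | left gP => HB.pack_for (cumulative R R) g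
                 (isCumulative.Build R _ R g (proj1 gP) (proj2 gP))
  | right _ => idfun
  end.

Definition stieltjes_measure g := lebesgue_stieltjes_measure (to_cumulative g).

HB.instance Definition _ g := Measure.on (stieltjes_measure g).

(* The convention a(0-) = 0 gives the signed measure da the mass a(0) at 0
   and its variation |da| the mass |a(0)|; variation_fun a, positive_part a
   and negative_part a are the distribution functions of |da|, da^+, da^-. *)
Definition variation_fun a : R -> R := fun s =>
  if 0 <= s then `|a 0| + fine (total_variation 0 s a) else 0.

Definition positive_part a : R -> R := fun s =>
  if 0 <= s then (variation_fun a s + a s) / 2 else 0.

Definition negative_part a : R -> R := fun s =>
  if 0 <= s then (variation_fun a s - a s) / 2 else 0.

Definition stop_path a t : R -> R := fun s => a (Num.min t s).

(* \int_[0,t] |h_s| |da_s| and \int_[0,t] h_s da_s. The path is stopped at t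
   because a need only be defined, cadlag and of finite variation on [0,t]. *)
Definition stieltjes_abs_integral h a t : \bar R :=
  (\int[stieltjes_measure (variation_fun (stop_path a t))]_(s in `[0%R, t%R])
     `|h s|%:E)%E.

Definition stieltjes_integral h a t : R :=
  Rintegral (stieltjes_measure (positive_part (stop_path a t))) `[0, t] h -
  Rintegral (stieltjes_measure (negative_part (stop_path a t))) `[0, t] h.

End paths.

Section processes.
Context {R : realType} {d : measure_display} {Om : measurableType d}.
Variables (P : probability Om R) (F : R -> set (set Om)).
Implicit Types (X Y H A : Om * R -> R) (B C : set (Om * R)).
Implicit Types (tau : Om -> \bar R).

(* filtration_complete makes (Om, P) complete as well, since F 0 consists of
   measurable sets. *)
Record usual_conditions : Prop := {
  filtration_sigma_algebra : forall t, 0 <= t -> sigma_algebra setT (F t);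
  filtration_measurable : forall t, 0 <= t -> F t `<=` measurable;
  filtration_increasing : forall s t, 0 <= s -> s <= t -> F s `<=` F t;
  filtration_right_continuous : forall t, 0 <= t ->
    \bigcap_(s in `]t, +oo[) F s = F t;
  filtration_complete : P.-negligible `<=` F 0 }.

Definition stopping_time tau : Prop :=
  (forall w, (0 <= tau w)%E) /\
  (forall t : R, 0 <= t -> F t [set w | (tau w <= t%:E)%E]).

Definition time_domain : set (Om * R) := [set: Om] `*` `[0, +oo[.

Definition adapted X : Prop := forall t : R, 0 <= t ->
  measurable_fun [set: g_sigma_algebraType (F t)] (fun w => X (w, t)).

(* The sets generating the optional and the predictable sigma-algebra are all
   subsets of time_domain = Om x R^+, which is one of them. Hence the subsets
   of time_domain in the sigma-algebra generated on Om * R are exactly those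
   in the sigma-algebra generated on Om x R^+. *)
Definition optional_generator : set (set (Om * R)) :=
  \bigcup_(X in [set X | adapted X /\ forall w, cadlag (fun t => X (w, t))])
    preimage_set_system time_domain X measurable.

Definition predictable_generator : set (set (Om * R)) :=
  \bigcup_(X in [set X | adapted X /\
                         forall w, left_continuous_path (fun t => X (w, t))])
    preimage_set_system time_domain X measurable.

Definition optional_set B : Prop :=
  B `<=` time_domain /\ <<s optional_generator >> B.

Definition predictable_set B : Prop :=
  B `<=` time_domain /\ <<s predictable_generator >> B.

Definition predictable_process : set (Om * R -> R) := [set X |
  measurable_fun (time_domain : set (g_sigma_algebraType predictable_generator))
    X].

Definition FV_process : set (Om * R -> R) := [set X | adapted X /\
  forall w, cadlag (fun t => X (w, t)) /\ finite_variation (fun t => X (w, t))].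

Definition indistinguishable X Y : Prop :=
  {ae P, forall w, forall t, 0 <= t -> X (w, t) = Y (w, t)}.

Definition stopped X tau : Om * R -> R := fun z =>
  X (z.1, fine (Order.min z.2%:E (tau z.1))).

Definition debut C : Om -> \bar R := fun w =>
  ereal_inf [set t%:E | t in [set t | 0 <= t /\ C (w, t)]].

(* The value tau w = +oo is allowed: B may be the whole of Om x R^+. *)
Definition interval_type B : Prop :=
  (optional_set B \/ predictable_set B) /\
  exists tau : Om -> \bar R,
    [/\ measurable_fun [set: Om] tau, forall w, (0 <= tau w)%E &
      forall w, xsection B w !=set0 /\
        (xsection B w = [set t | 0 <= t /\ (t%:E < tau w)%E] \/
         xsection B w = [set t | 0 <= t /\ (t%:E <= tau w)%E])].

(* A real function on B is represented by a function on Om * R, whose values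
   outside B are irrelevant. X \_ B is X on B and 0 elsewhere. *)

Definition eq_on B X Y : Prop := indistinguishable (X \_ B) (Y \_ B).

Record FCS (D : set (Om * R -> R)) B X (T_ : nat -> Om -> \bar R)
    (X_ : nat -> Om * R -> R) : Prop := {
  FCS_stopping : forall n, stopping_time (T_ n);
  FCS_increasing : forall w, {homo T_ ^~ w : m n / (m <= n)%N >-> (m <= n)%E};
  FCS_cvg : forall w, T_ n w @[n --> \oo] --> debut (~` B) w;
  FCS_cover : B `<=`
    \bigcup_n [set z | 0 <= z.2 /\ (z.2%:E <= T_ n z.1)%E];
  FCS_class : forall n, D (X_ n);
  FCS_coupled : forall n,
    indistinguishable (stopped (X \_ B) (T_ n)) (stopped (X_ n \_ B) (T_ n)) }.

Definition local_class (D : set (Om * R -> R)) B : set (Om * R -> R) :=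
  [set X | exists (T_ : nat -> Om -> \bar R) (X_ : nat -> Om * R -> R),
     FCS D B X T_ X_].

(* Since indistinguishable processes are identified, pathwise integrability
   is required for almost every w. *)
Definition stieltjes_integrable A : set (Om * R -> R) := [set H |
  predictable_process H /\
  {ae P, forall w, forall t, 0 <= t ->
    (stieltjes_abs_integral (fun s => H (w, s)) (fun s => A (w, s)) t
       < +oo)%E}].

Definition pathwise_integral H A : Om * R -> R := fun z =>
  stieltjes_integral (fun s => H (z.1, s)) (fun s => A (z.1, s)) z.2.

Definition B_stieltjes_integrable B A : set (Om * R -> R) := [set H |
  [/\ local_class predictable_process B H,
    {ae P, forall w, forall t, B (w, t) ->
      (stieltjes_abs_integral (fun s => H (w, s)) (fun s => A (w, s)) t
         < +oo)%E} &
    local_class FV_process B (pathwise_integral H A)]].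

Definition coupled_predictable B H H' : Prop :=
  predictable_process H' /\ eq_on B H H'.

End processes.

(* Main.v *)
(* (A1) => (A2): H has a coupled predictable process H', obtained by gluing the
   members of an FCS along ]]T_(n-1), T_n]].  Let (R_n, A^(n)) be an FCS for A and
   V^n_t = \int_[0,t] |H'| |dA^(n)|, an adapted nondecreasing process which agrees
   with \int_[0,t] |H| |dA| < +oo on B[[0, R_n]].  Put
   T_n = R_n /\ inf {t | V^n_t >= n}.  Since V^n is finite on B, T_n still increases to T,
   and V^n <= n on [[0, T_n[[, while the time T_n itself only contributes the finite
   amount |H'| |dA^(n)| at one point; so H' is integrable with respect to A^(n)
   stopped at T_n.  (A3) => (A2) is the same stopping argument with T_n given.
   (A2) => (A1) amounts to showing that H'.A^(n) is again an adapted cadlag process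
   of finite variation.  Adaptedness, of H'.A^(n) as of V^n, holds because
   predictable processes are progressive and the Stieltjes measures of the paths
   form a kernel; the latter rests on the measurability of the total variation,
   which is a limit of variations along grids. *)

Require Import Defs.
From HB Require Import structures.
From mathcomp Require Import all_boot all_order all_algebra.
From mathcomp Require Import all_classical all_reals all_analysis.
From mathcomp Require Import measurable_realfun lra.

Set Implicit Arguments.
Unset Strict Implicit.
Unset Printing Implicit Defensive.

Import Order.TTheory GRing.Theory Num.Theory.
Import numFieldNormedType.Exports.

Local Open Scope classical_set_scope.
Local Open Scope ring_scope.

(** * Stieltjes measures *)

Section stieltjes_measures.
Context {R : realType}.
Implicit Types (a g : R -> R) (s t : R).

(** A coupling says nothing outside B, and [T_n] may already be the end of B without belonging to
    it. Every estimate is therefore made on [[0, T_n[]. The endpoint is then absorbed as one finite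
    mass, and stopping the integrator at [T_n] removes all that comes later. The level n of the
    hitting time serves twice: it tends to infinity, so that the new times exhaust B, and it
    increases with n, which keeps these times increasing because V^m and V^n agree on B up to R_m
    for m <= n. Integrability is known only almost surely, whereas monotone stopping times and
    cadlag paths are demanded for every w. Completeness of F_0 allows corrections on a null set
    without losing adaptedness. *)

Definition distribution_function g : Prop :=
  {homo g : x y / x <= y} /\ right_continuous g.

Lemma stieltjes_measure_itv g x y : distribution_function g -> x <= y ->
  stieltjes_measure g `]x, y] = (g y - g x)%:E.
Proof.
move=> gP xy; rewrite /stieltjes_measure /lebesgue_stieltjes_measure.
rewrite /measure_extension measurable_mu_extE; last exact: is_ocitv.
have gE : (to_cumulative g : R -> R) = g by rewrite /to_cumulative; case: pselect.
by rewrite -[in RHS]gE; exact: wlength_itv_bnd.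
Qed.

Lemma stieltjes_measure_unique g
    (mu : {measure set (measurableTypeR R) -> \bar R}) :
  distribution_function g ->
  (forall x y : R, x <= y -> mu `]x, y]%classic = (g y - g x)%:E) ->
  forall D, measurable D -> stieltjes_measure g D = mu D.
Proof.
move=> gP muE; apply: lebesgue_stieltjes_measure_unique => _ [[x y] _ <-] /=.
have [xy|yx] := leP x y.
  by rewrite muE//; exact: stieltjes_measure_itv.
by rewrite set_itv_ge ?bnd_simp -?leNgt ?ltW// !measure0.
Qed.

Lemma distribution_function_stop g t : distribution_function g ->
  distribution_function (fun s => g (Num.min t s)).
Proof.
move=> [g_nd g_rc]; split=> [x y xy|s].
  by apply: g_nd; rewrite le_min !ge_min lexx xy orbT.
have [ts|st] := leP t s.
  apply: (@cvg_near_cst _ _ _ _ _ _).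
  near=> x.
  suff : t <= x by move=> /min_idPl ->.
  by apply: (le_trans ts); near: x; exact: nbhs_right_ge.
apply: cvg_trans (g_rc s); apply: near_eq_cvg; near=> x.
suff : x <= t by move=> /min_idPr ->.
by near: x; exact: nbhs_right_le.
Unshelve. all: by end_near. Qed.

Lemma stieltjes_measure_stop g t (D : set (measurableTypeR R)) :
  distribution_function g -> measurable D ->
  stieltjes_measure (fun s => g (Num.min t s)) D =
  stieltjes_measure g (D `&` `]-oo, t]).
Proof.
move=> gP mD.
have mt : measurable (`]-oo, t] : set (measurableTypeR R)).
  exact: (@measurable_itv R).
rewrite (@stieltjes_measure_unique _ (mrestr (stieltjes_measure g) mt))//.
  exact: distribution_function_stop.
move=> x y xy; rewrite /mrestr.
transitivity (stieltjes_measure g `]Num.min t x, Num.min t y]%classic); last first.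
  by rewrite stieltjes_measure_itv// le_min !ge_min lexx xy orbT.
congr (stieltjes_measure g _).
apply/seteqP; split=> z /=; rewrite !in_itv/= gt_min le_min.
  by move=> [/andP[-> ->] ->]; rewrite orbT.
case/andP=> /orP[tz /andP[zt]|-> /andP[-> ->]//].
by rewrite leNgt tz in zt.
Qed.

Lemma distribution_functionD g1 g2 : distribution_function g1 ->
  distribution_function g2 -> distribution_function (g1 \+ g2).
Proof.
move=> [g1_nd g1_rc] [g2_nd g2_rc]; split=> [x y xy /=|x].
  by apply: lerD; [exact: g1_nd|exact: g2_nd].
by apply: cvgD; [exact: g1_rc|exact: g2_rc].
Qed.

Lemma stieltjes_measureD g1 g2 (D : set (measurableTypeR R)) :
  distribution_function g1 -> distribution_function g2 -> measurable D ->
  stieltjes_measure (g1 \+ g2) D =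
  (stieltjes_measure g1 D + stieltjes_measure g2 D)%E.
Proof.
move=> g1P g2P mD; rewrite -measure_addE.
apply: stieltjes_measure_unique => //; first exact: distribution_functionD.
move=> x y xy.
transitivity (stieltjes_measure g1 `]x, y]%classic +
  stieltjes_measure g2 `]x, y]%classic)%E; first exact: measure_addE.
rewrite !stieltjes_measure_itv//.
by rewrite -EFinD opprD addrACA.
Qed.

(** Common shape of the distribution functions of |da|, da^+ and da^-. The value 0 on negative times
    puts the mass [g 0] at time 0, as the convention a(0-) = 0 requires. *)
Definition cut_at0 g s : R := if 0 <= s then g s else 0.

Lemma distribution_function_cut_at0 g : 0 <= g 0 ->
  (forall x y, 0 <= x -> x <= y -> g x <= g y) ->
  (forall t, 0 <= t -> g x @[x --> t^'+] --> g t) ->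
  distribution_function (cut_at0 g).
Proof.
move=> g0 g_nd g_rc; split=> [x y xy|t]; rewrite /cut_at0.
  have [x0|x0] := leP 0 x; first by rewrite (le_trans x0 xy) g_nd.
  by case: ifPn => // y0; rewrite (le_trans g0)// g_nd.
have [t0|t0] := leP 0 t.
  apply: cvg_trans (g_rc t t0); apply: near_eq_cvg; near=> x.
  suff -> : 0 <= x by [].
  by apply: (le_trans t0); near: x; exact: nbhs_right_ge.
apply: (@cvg_near_cst _ _ _ _ _ _); near=> x.
suff : x < 0 by rewrite ltNge => /negbTE ->.
by near: x; exact: nbhs_right_lt.
Unshelve. all: by end_near. Qed.

Lemma cut_at0_stop g t : 0 <= t ->
  cut_at0 (fun s => g (Num.min t s)) = (fun s => cut_at0 g (Num.min t s)).
Proof. by move=> t0; apply/funext => s; rewrite /cut_at0 le_min t0. Qed.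

End stieltjes_measures.

(** * Total variation and Jordan parts of a path *)

Section nice_paths.
Context {R : realType}.
Implicit Types (a g : R -> R) (s t : R).

Definition FV_path a : Prop := cadlag a /\ finite_variation a.

Lemma eq_total_variation (x y : R) a a' :
  (forall z, x <= z <= y -> a z = a' z) ->
  total_variation x y a = total_variation x y a'.
Proof.
suff H f h : (forall z, x <= z <= y -> f z = h z) ->
    variations x y f `<=` variations x y h.
  move=> aa'; rewrite /total_variation; congr (ereal_sup (_ @` _)).
  by apply/seteqP; split; apply: H => z /aa'.
move=> fh _ [l xyl <-]; exists l => //.
rewrite /variation !big_mkord; apply: eq_bigr => i _ /=.
have il : (i < (size l).+1)%N by rewrite ltnW// ltnS ltn_ord.
have := itv_partition_nth_ge il xyl; have := itv_partition_nth_le il xyl.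
have il' : (i.+1 < (size l).+1)%N by rewrite ltnS ltn_ord.
have := itv_partition_nth_ge il' xyl; have := itv_partition_nth_le il' xyl.
by move=> /= u1 u2 u3 u4; rewrite !fh ?u1 ?u2 ?u3 ?u4.
Qed.

Lemma total_variation_stop a s t : 0 <= s -> 0 <= t ->
  total_variation 0 s (stop_path a t) = total_variation 0 (Num.min t s) a.
Proof.
move=> s0 t0; have [ts|st] := leP t s.
  rewrite (total_variationD _ t0 ts) [X in (_ + X)%E](_ : _ = 0%E) ?adde0.
    apply: eq_total_variation => z /andP[_ zt].
    by rewrite /stop_path; move/min_idPr : zt => ->.
  rewrite (@eq_total_variation _ _ _ (cst (a t))).
    by rewrite nondecreasing_total_variation// subrr.
  by move=> z /andP[tz _]; rewrite /stop_path; move/min_idPl : tz => ->.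
apply: eq_total_variation => z /andP[_ zt].
have /min_idPr : z <= t by rewrite (le_trans zt)// ltW.
by rewrite /stop_path => ->.
Qed.

Lemma total_variation_fin a t : FV_path a -> 0 <= t ->
  total_variation 0 t a \is a fin_num.
Proof. by move=> [_ fa] t0; apply/bounded_variationP => //; exact: fa. Qed.

Lemma variation_funE a : variation_fun a =
  cut_at0 (fun s => `|a 0| + fine (total_variation 0 s a)).
Proof. by []. Qed.

Lemma positive_partE a : positive_part a =
  cut_at0 (fun s => (variation_fun a s + a s) / 2).
Proof. by []. Qed.

Lemma negative_partE a : negative_part a =
  cut_at0 (fun s => (variation_fun a s - a s) / 2).
Proof. by []. Qed.

Lemma variation_fun_stop a t : 0 <= t ->
  variation_fun (stop_path a t) = (fun s => variation_fun a (Num.min t s)).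
Proof.
move=> t0; rewrite !variation_funE -cut_at0_stop//.
apply/funext => s; rewrite /cut_at0; case: ifPn => // s0.
by rewrite total_variation_stop// /stop_path; move/min_idPr: (t0) => ->.
Qed.

Lemma positive_part_stop a t : 0 <= t ->
  positive_part (stop_path a t) = (fun s => positive_part a (Num.min t s)).
Proof. by move=> t0; rewrite !positive_partE variation_fun_stop// -cut_at0_stop. Qed.

Lemma negative_part_stop a t : 0 <= t ->
  negative_part (stop_path a t) = (fun s => negative_part a (Num.min t s)).
Proof. by move=> t0; rewrite !negative_partE variation_fun_stop// -cut_at0_stop. Qed.

(** The variation on [[s, t]] dominates the single increment. This makes both [variation_fun a + a]
    and [variation_fun a - a] nondecreasing, so that the Jordan parts are distribution functions. *)
Lemma variation_funB a s t : FV_path a -> 0 <= s -> s <= t ->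
  `|a t - a s| <= variation_fun a t - variation_fun a s.
Proof.
move=> aP s0 st; have t0 := le_trans s0 st.
have sf := total_variation_fin aP s0; have tf := total_variation_fin aP t0.
rewrite /variation_fun s0 t0 opprD addrACA subrr add0r -fineB//.
rewrite -lee_fin fineK ?fin_numB ?tf//.
rewrite (total_variationD _ s0 st) addeAC subee// add0e.
exact: total_variation_ge.
Qed.

Lemma cvg_variation_fun a t : FV_path a -> 0 <= t ->
  variation_fun a x @[x --> t^'+] --> variation_fun a t.
Proof.
move=> aP t0.
have : `|a 0| + fine (total_variation 0 x a) @[x --> t^'+] --> variation_fun a t.
  rewrite /variation_fun t0; apply: cvgD; first exact: cvg_cst.
  apply: (@total_variation_right_continuous _ _ (t + 1)) => //.
  - by rewrite ltrDl.
  - by case: aP => /(_ _ t0)[].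
  - by case: aP => _; apply; rewrite addr_ge0.
apply: cvg_trans; apply: near_eq_cvg; near=> x.
rewrite /variation_fun ifT//.
by apply: (le_trans t0); near: x; exact: nbhs_right_ge.
Unshelve. all: by end_near. Qed.

Lemma variation_fun_ge a t : FV_path a -> 0 <= t -> `|a t| <= variation_fun a t.
Proof.
move=> aP t0; rewrite -(subrK (a 0) (a t)) (le_trans (ler_normD _ _))//.
have := variation_funB aP (lexx 0) t0.
rewrite {2}/variation_fun lexx total_variationxx /= addr0 lerBrDr.
by [].
Qed.

Lemma variation_fun_distribution a : FV_path a ->
  distribution_function (variation_fun a).
Proof.
move=> aP; rewrite variation_funE; apply: distribution_function_cut_at0.
- by rewrite addr_ge0// fine_ge0// total_variation_ge0.
- move=> x y x0 xy; have := variation_funB aP x0 xy.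
  rewrite /variation_fun x0 (le_trans x0 xy) => h.
  by rewrite -subr_ge0 (le_trans _ h).
- move=> t t0; have := cvg_variation_fun aP t0; rewrite {2}/variation_fun t0.
  apply: cvg_trans; apply: near_eq_cvg; near=> x.
  rewrite /variation_fun ifT//.
  by apply: (le_trans t0); near: x; exact: nbhs_right_ge.
Unshelve. all: by end_near. Qed.

Lemma positive_part_distribution a : FV_path a ->
  distribution_function (positive_part a).
Proof.
move=> aP; rewrite positive_partE; apply: distribution_function_cut_at0.
- have := variation_fun_ge aP (lexx 0); rewrite ler_norml => /andP[h _].
  lra.
- move=> x y x0 xy; have := variation_funB aP x0 xy.
  rewrite ler_norml => /andP[h _].
  lra.
- move=> t t0; apply: cvgMr_tmp; apply: cvgD; first exact: cvg_variation_fun.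
  by case: aP => /(_ _ t0)[].
Qed.

Lemma negative_part_distribution a : FV_path a ->
  distribution_function (negative_part a).
Proof.
move=> aP; rewrite negative_partE; apply: distribution_function_cut_at0.
- have := variation_fun_ge aP (lexx 0); rewrite ler_norml => /andP[_ h].
  lra.
- move=> x y x0 xy; have := variation_funB aP x0 xy.
  rewrite ler_norml => /andP[_ h].
  lra.
- move=> t t0; apply: cvgMr_tmp; apply: cvgB; first exact: cvg_variation_fun.
  by case: aP => /(_ _ t0)[].
Qed.

Lemma positive_negative_part a :
  positive_part a \+ negative_part a = variation_fun a.
Proof.
apply/funext => s /=; rewrite /positive_part /negative_part.
by case: ifPn => [_|/negbTE s0]; [lra|rewrite /variation_fun s0 addr0].
Qed.

End nice_paths.

(** * Indefinite integrals of a nonnegative function *)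

Section integral_over_itv.
Context {R : realType} (mu : {measure set (measurableTypeR R) -> \bar R}).
Variable f : measurableTypeR R -> \bar R.
Hypothesis f0 : forall s, (0 <= f s)%E.
Hypothesis mf : measurable_fun (`[0, +oo[%classic : set (measurableTypeR R)) f.

Lemma measurableTypeR_itv (i : interval R) :
  measurable ([set` i] : set (measurableTypeR R)).
Proof. exact: (@measurable_itv R). Qed.

Let mfS (D : set (measurableTypeR R)) : D `<=` `[0%R, +oo[%classic ->
  measurable_fun D f.
Proof.
by move=> D0; apply: measurable_funS mf => //; exact: measurableTypeR_itv.
Qed.

Let mfi (a : R) b c : 0 <= a -> measurable_fun
  ([set` Interval (BSide b a) c] : set (measurableTypeR R)) f.
Proof.
move=> a0; apply: mfS => x /=; rewrite !in_itv/= andbT => /andP[ax _].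
by case: b ax => /= ax; rewrite (le_trans a0)// ltW.
Qed.

Lemma le_integral_left (r : R) (M : \bar R) : 0 < r ->
  (forall u : R, 0 <= u -> u < r -> (\int[mu]_(s in `[0%R, u]) f s <= M)%E) ->
  (\int[mu]_(s in `[0%R, r[) f s <= M)%E.
Proof.
move=> r0 fM; rewrite itv_bnd_open_bigcup.
(* Covers the indices n for which [[0, r - 1/(n+1)]] is empty. *)
have M0 : (0 <= M)%E.
  by apply: (le_trans _ (fM 0 (lexx 0) r0)); exact: integral_ge0.
pose F n := `[0, r - n.+1%:R^-1]%classic : set (measurableTypeR R).
have /cvge_to_le : (\int[mu]_(s in F n) f s @[n --> \oo] -->
                    \int[mu]_(s in \bigcup_n F n) f s)%E.
  apply: ge0_nondecreasing_set_cvg_integral => //.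
  - move=> m n mn; apply/subsetPset => x; rewrite /F/= !in_itv/= => /andP[-> /=].
    move/le_trans; apply; rewrite lerB// lef_pV2 ?posrE//.
    by rewrite ler_nat ltnS.
  - by move=> i; exact: measurableTypeR_itv.
  - by move=> i; exact: mfi.
apply; near=> n; rewrite /F; have [n0|n0] := leP 0 (r - n.+1%:R^-1).
  by apply: fM => //; rewrite ltrBlDr ltrDl.
by rewrite set_itv_ge ?integral_set0// bnd_simp -ltNge.
Unshelve. all: by end_near. Qed.

Lemma integral_itvUoc (a b : R) : 0 <= a -> a <= b ->
  (\int[mu]_(s in `[0%R, b]) f s =
   \int[mu]_(s in `[0%R, a]) f s + \int[mu]_(s in `]a, b]) f s)%E.
Proof.
move=> a0 ab.
have abE : `[0, b]%classic = `[0, a]%classic `|` `]a, b]%classic :> set R.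
  rewrite -itv_bndbnd_setU// bnd_simp//.
rewrite abE ge0_integral_setU//.
- by rewrite -abE; exact: mfi.
- apply/disj_setPS => x /= []; rewrite !in_itv/= => /andP[_ xa] /andP[ax _].
  by rewrite leNgt ax in xa.
Qed.

Lemma integral_itv_nd (a b : R) : a <= b ->
  (\int[mu]_(s in `[0%R, a]) f s <= \int[mu]_(s in `[0%R, b]) f s)%E.
Proof.
move=> ab; apply: ge0_subset_integral => //.
- exact: mfi.
- by move=> x /=; rewrite !in_itv/= => /andP[-> /le_trans]; exact.
Qed.

Hypothesis ffin : forall t : R, 0 <= t -> (\int[mu]_(s in `[0%R, t]) f s < +oo)%E.

Let I (t : R) := fine (\int[mu]_(s in `[0%R, t]) f s).

Let IE (t : R) : 0 <= t -> (I t)%:E = (\int[mu]_(s in `[0%R, t]) f s)%E.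
Proof. by move=> t0; rewrite fineK// ge0_fin_numE ?ffin ?integral_ge0. Qed.

Let I_nd (x y : R) : 0 <= x -> x <= y -> I x <= I y.
Proof.
by move=> x0 xy; rewrite -lee_fin !IE ?(le_trans x0)//; exact: integral_itv_nd.
Qed.

(** Monotonicity yields finite variation and left limits. Right-continuity is monotone convergence
    on the intervals [[t + 1/(n+1), t + 1]], which fill []t, t + 1]] and leave an arbitrarily small
    integral next to t. *)
Lemma FV_path_integral : FV_path I.
Proof.
split=> t t0; last first.
  by apply: nondecreasing_bounded_variation => x y; rewrite !in_itv/= =>
    /andP[x0 _] _; exact: I_nd.
split=> [|{}t0].
  have t1 : 0 <= t + 1 by rewrite addr_ge0.
  have tt1 : t <= t + 1 by rewrite lerDl.
  have split1 := integral_itvUoc t0 tt1.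
  set J := (\int[mu]_(s in `]t, (t + 1)%R]) f s)%E in split1.
  have Jfin : J \is a fin_num.
    rewrite ge0_fin_numE; last exact: integral_ge0.
    apply: le_lt_trans (ffin t1); rewrite split1 leeDr//.
    exact: integral_ge0.
  have cJ : (\int[mu]_(s in `[(t + n.+1%:R^-1)%R, (t + 1)%R]) f s)%E @[n --> \oo] --> J.
    rewrite /J itv_open_bnd_bigcup; apply: ge0_nondecreasing_set_cvg_integral.
    - move=> m n mn; apply/subsetPset => x /=; rewrite !in_itv/= => /andP[+ ->].
      rewrite andbT; apply: le_trans; rewrite lerD2l lef_pV2 ?posrE//.
      by rewrite ler_nat ltnS.
    - by move=> i; exact: measurableTypeR_itv.
    - by move=> i; apply: mfi; rewrite addr_ge0.
    - by [].
  apply/cvgrPdist_le => e e0.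
  have [n nJ] : exists n : nat,
      (J - e%:E < \int[mu]_(s in `[(t + n.+1%:R^-1)%R, (t + 1)%R]) f s)%E.
    apply: contrapT => nJe; have : (J <= J - e%:E)%E.
      apply: cvge_to_le cJ _; apply: nearW => n.
      by rewrite leNgt; apply/negP => Jn; apply: nJe; exists n.
    by rewrite -(fineK Jfin) -EFinB lee_fin lerBrDr gerDl leNgt e0.
  (* For x between t and t + 1/(n+1), the integral over []x, t + 1]] still exceeds J - e, so less
     than e is left for []t, x]]. *)
  near=> x.
  have tx : t < x by near: x; exact: nbhs_right_gt.
  have x0 : 0 <= x by rewrite (le_trans t0)// ltW.
  have xn : x < t + n.+1%:R^-1 by near: x; apply: nbhs_right_lt; rewrite ltrDl.
  have Itx : I t <= I x by apply: I_nd => //; exact: ltW.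
  rewrite distrC ger0_norm ?subr_ge0// lerBlDr.
  have n1 : t + n.+1%:R^-1 <= t + 1.
    by rewrite lerD2l invf_le1// ler1n.
  have xt1 : x <= t + 1 by rewrite (le_trans _ n1)// ltW.
  have split2 := integral_itvUoc x0 xt1.
  have : (\int[mu]_(s in `[(t + n.+1%:R^-1)%R, (t + 1)%R]) f s <=
          \int[mu]_(s in `]x, (t + 1)%R]) f s)%E.
    apply: ge0_subset_integral => //.
    - exact: mfi.
    - by move=> y /=; rewrite !in_itv/= => /andP[/(lt_le_trans xn) -> ->].
  move=> /(lt_le_trans nJ).
  move: split2; rewrite split1 -!IE//.
  have : (\int[mu]_(s in `]x, (t + 1)%R]) f s \is a fin_num)%E.
    rewrite ge0_fin_numE; last exact: integral_ge0.
    apply: le_lt_trans (ffin t1); rewrite (integral_itvUoc x0 xt1) leeDr//.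
    exact: integral_ge0.
  move=> /fineK <-; rewrite -(fineK Jfin) -EFinB -!EFinD lte_fin => -[].
  by move=> h1 h2; lra.
apply: nondecreasing_at_left_is_cvgr; near=> x.
  move=> y z; rewrite !in_itv/= => /andP[xy _] /andP[xz _]; apply: I_nd.
  by rewrite (le_trans _ (ltW xy))//; near: x; exact: nbhs_left_ge.
exists (I t) => _ [y /= + <-]; rewrite in_itv/= => /andP[xy yt].
apply: I_nd; last exact: ltW.
by rewrite (le_trans _ (ltW xy))//; near: x; exact: nbhs_left_ge.
Unshelve. all: by end_near. Qed.

End integral_over_itv.

(** * Closure properties of cadlag paths of finite variation *)

Section FV_path_theory.
Context {R : realType}.
Implicit Types (a g h : R -> R) (s t : R).

Lemma eq_FV_path a g : (forall t, 0 <= t -> a t = g t) -> FV_path a -> FV_path g.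
Proof.
move=> ag [ca fa]; split=> t t0.
  have [ra la] := ca t t0; split=> [|t_gt0].
    rewrite -ag//; apply: cvg_trans ra; apply: near_eq_cvg; near=> x.
    by rewrite ag// (le_trans t0)//; near: x; exact: nbhs_right_ge.
  have /cvg_ex[l al] := la t_gt0; apply/cvg_ex; exists l.
  apply: cvg_trans al; apply: near_eq_cvg; near=> x.
  by rewrite ag//; near: x; exact: nbhs_left_ge.
apply/bounded_variationP => //.
rewrite -(@eq_total_variation _ _ _ a); last by move=> z /andP[/ag ->].
exact: total_variation_fin.
Unshelve. all: by end_near. Qed.

Lemma FV_pathD a g : FV_path a -> FV_path g -> FV_path (a \+ g).
Proof.
move=> [ca fa] [cg fg]; split=> t t0.
  have [ra la] := ca t t0; have [rg lg] := cg t t0.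
  split=> [|t_gt0]; first exact: cvgD.
  by apply: is_cvgD; [exact: la|exact: lg].
move: (t0); rewrite le_eqVlt => /predU1P[<-|t_gt0].
  exact: bounded_variationxx.
by apply: bounded_variationD => //; [exact: fa|exact: fg].
Qed.

Lemma FV_pathN a : FV_path a -> FV_path (\- a).
Proof.
move=> [ca fa]; split=> t t0; last by apply: bounded_variationN; exact: fa.
have [ra la] := ca t t0; split=> [|t_gt0]; first exact: cvgN.
by apply: is_cvgN; exact: la.
Qed.

Lemma FV_path_stop a r : 0 <= r -> FV_path a -> FV_path (stop_path a r).
Proof.
move=> r0 aP; split=> t t0; last first.
  apply/bounded_variationP => //; rewrite total_variation_stop//.
  by apply: total_variation_fin => //; rewrite le_min r0.
case: aP => /(_ t t0)[ra la] _; split=> [|t_gt0].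
  have [rt|tr] := leP r t.
    apply: (cvg_near_cst (stop_path a r t)); near=> x.
    have tx : t <= x by near: x; exact: nbhs_right_ge.
    have /min_idPl := le_trans rt tx.
    by rewrite /stop_path => ->; move/min_idPl : rt => ->.
  rewrite {2}/stop_path; move/ltW/min_idPr : (tr) => ->.
  apply: cvg_trans ra; apply: near_eq_cvg; near=> x; rewrite /stop_path.
  suff /min_idPr -> : x <= r by [].
  by near: x; exact: nbhs_right_le.
have [rt|tr] := ltP r t.
  apply/cvg_ex; exists (a r).
  apply: cvg_near_cst; near=> x; rewrite /stop_path.
  suff /min_idPl -> : r <= x by [].
  by near: x; exact: nbhs_left_ge.
have /cvg_ex[l al] := la t_gt0; apply/cvg_ex; exists l.
apply: cvg_trans al; apply: near_eq_cvg; near=> x; rewrite /stop_path.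
suff /min_idPr -> : x <= r by [].
apply: le_trans tr; near: x; exact: nbhs_left_le.
Unshelve. all: by end_near. Qed.

End FV_path_theory.

(* Without this, unification between two integrals unfolds the Caratheodory
   extensions underlying their measures. *)
Local Opaque stieltjes_measure variation_fun positive_part negative_part.

(** * Stieltjes integrals along a path *)

Section stieltjes_integrals.
Context {R : realType}.
Implicit Types (a g h : R -> R) (r s t : R).

Local Notation TR := (measurableTypeR R).

Lemma stieltjes_measure_stop_sub g t (D : set TR) :
  distribution_function g -> measurable D -> D `<=` `[0%R, t] ->
  stieltjes_measure (fun s => g (Num.min t s)) D = stieltjes_measure g D.
Proof.
move=> gP mD Dt; rewrite stieltjes_measure_stop//; congr (stieltjes_measure g _).
by apply/setIidPl => x /Dt /=; rewrite !in_itv/= => /andP[].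
Qed.

(** For a path that is regular on the whole half-line the stopping in the definition can be undone,
    so that a single measure serves all t. *)
Lemma stieltjes_abs_integralE h a t : FV_path a -> 0 <= t ->
  stieltjes_abs_integral h a t =
  (\int[stieltjes_measure (variation_fun a)]_(s in `[0%R, t]) `|h s|%:E)%E.
Proof.
move=> aP t0; rewrite /stieltjes_abs_integral (variation_fun_stop a t0).
apply: eq_measure_integral => D mD Dt.
exact: (stieltjes_measure_stop_sub (variation_fun_distribution aP) mD Dt).
Qed.

Lemma Rintegral_stop g h t : distribution_function g ->
  Rintegral (stieltjes_measure (fun s => g (Num.min t s))) `[0, t] h =
  Rintegral (stieltjes_measure g) `[0, t] h.
Proof.
move=> gP; apply: (congr1 fine); apply: eq_measure_integral => D mD Dt.
exact: (stieltjes_measure_stop_sub gP mD Dt).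
Qed.

Lemma stieltjes_integralE h a t : FV_path a -> 0 <= t ->
  stieltjes_integral h a t =
  Rintegral (stieltjes_measure (positive_part a)) `[0, t] h -
  Rintegral (stieltjes_measure (negative_part a)) `[0, t] h.
Proof.
move=> aP t0; rewrite /stieltjes_integral.
rewrite (positive_part_stop a t0) (negative_part_stop a t0).
exact: (f_equal2 (fun x y : R => x - y)
  (Rintegral_stop h t (positive_part_distribution aP))
  (Rintegral_stop h t (negative_part_distribution aP))).
Qed.

Lemma stieltjes_abs_integral_ge0 h a t : (0 <= stieltjes_abs_integral h a t)%E.
Proof. exact: integral_ge0. Qed.

Lemma eq_variation_fun_stop a a' t :
  (forall s, 0 <= s <= t -> a s = a' s) -> 0 <= t ->
  variation_fun (stop_path a t) = variation_fun (stop_path a' t).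
Proof.
move=> aa' t0; apply/funext => s; rewrite !variation_funE /cut_at0; case: ifPn => // s0.
have E z : 0 <= z -> stop_path a t z = stop_path a' t z.
  by move=> z0; rewrite /stop_path aa'// le_min t0 z0 ge_min lexx.
rewrite E//; congr (_ + fine _); apply: eq_total_variation => z /andP[z0 _].
exact: E.
Qed.

(** The path is stopped at t in the definition, so only its values on [[0, t]] count. As a and a'
    are arbitrary, this transfers integrals between A, which is regular only inside B, and the
    members of its FCS. *)
Lemma eq_stieltjes_abs_integral h h' a a' t : 0 <= t ->
  (forall s, 0 <= s <= t -> h s = h' s) ->
  (forall s, 0 <= s <= t -> a s = a' s) ->
  stieltjes_abs_integral h a t = stieltjes_abs_integral h' a' t.
Proof.
move=> t0 hh' aa'; rewrite /stieltjes_abs_integral (eq_variation_fun_stop aa' t0).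
by apply: eq_integral => s; rewrite inE/= in_itv/= => /hh' ->.
Qed.

Lemma eq_stieltjes_integral h h' a a' t : 0 <= t ->
  (forall s, 0 <= s <= t -> h s = h' s) ->
  (forall s, 0 <= s <= t -> a s = a' s) ->
  stieltjes_integral h a t = stieltjes_integral h' a' t.
Proof.
move=> t0 hh' aa'; rewrite /stieltjes_integral.
have E s : 0 <= s -> stop_path a t s = stop_path a' t s.
  by move=> s0; rewrite /stop_path aa'// le_min t0 s0 ge_min lexx.
have -> : positive_part (stop_path a t) = positive_part (stop_path a' t).
  apply/funext => s; rewrite !positive_partE /cut_at0 (eq_variation_fun_stop aa' t0).
  by case: ifPn => // s0; rewrite E.
have -> : negative_part (stop_path a t) = negative_part (stop_path a' t).
  apply/funext => s; rewrite !negative_partE /cut_at0 (eq_variation_fun_stop aa' t0).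
  by case: ifPn => // s0; rewrite E.
by congr (_ - _); apply: eq_Rintegral => s; rewrite inE/= in_itv/= => /hh' ->.
Qed.

Section integrand.
Variables (h a : R -> R).
Hypothesis mh : measurable_fun (`[0, +oo[%classic : set TR) h.
Hypothesis aP : FV_path a.

Let h_abs (s : TR) : \bar R := `|h s|%:E.

Let h_abs0 s : (0 <= h_abs s)%E. Proof. by rewrite lee_fin. Qed.

Let mh_abs : measurable_fun (`[0, +oo[%classic : set TR) h_abs.
Proof. by apply/measurable_EFinP; exact: measurableT_comp. Qed.

Let h_abs_itv b (c : itv_bound R) : measurable_fun
  ([set` Interval (BSide b 0) c] : set TR) h_abs.
Proof.
apply: measurable_funS mh_abs; first exact: measurableTypeR_itv.
by move=> x /=; rewrite !in_itv/= andbT => /andP[]; case: b => //= /ltW.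
Qed.

Lemma stieltjes_abs_integral_nd s t : 0 <= s -> s <= t ->
  (stieltjes_abs_integral h a s <= stieltjes_abs_integral h a t)%E.
Proof.
move=> s0 st; have t0 := le_trans s0 st.
rewrite (stieltjes_abs_integralE h aP s0) (stieltjes_abs_integralE h aP t0).
exact: (integral_itv_nd _ h_abs0 mh_abs).
Qed.

(** A path stopped at r has no variation on []r, t]], which is thus a null set of its measure. *)
Lemma stieltjes_abs_integral_stop r t : 0 <= r -> 0 <= t ->
  (stieltjes_abs_integral h (stop_path a r) t <=
   stieltjes_abs_integral h a r)%E.
Proof.
move=> r0 t0; have [tr|rt] := leP t r.
  have -> : stieltjes_abs_integral h (stop_path a r) t = stieltjes_abs_integral h a t.
    apply: eq_stieltjes_abs_integral => // s /andP[_ /le_trans/(_ tr)].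
    by rewrite /stop_path => /min_idPr ->.
  exact: stieltjes_abs_integral_nd.
have arP := FV_path_stop r0 aP.
rewrite (stieltjes_abs_integralE h arP t0).
rewrite (integral_itvUoc _ h_abs0 mh_abs r0 (ltW rt)).
rewrite -(stieltjes_abs_integralE h arP r0).
have -> : stieltjes_abs_integral h (stop_path a r) r = stieltjes_abs_integral h a r.
  apply: eq_stieltjes_abs_integral => // s /andP[_].
  by rewrite /stop_path => /min_idPr ->.
rewrite [X in (_ + X)%E]null_set_integral ?adde0//.
  apply: measurable_funS mh_abs; first exact: measurableTypeR_itv.
  move=> x /=; rewrite !in_itv/= andbT => /andP[/ltW rx _].
  exact: le_trans rx.
have vP := variation_fun_distribution arP.
apply: etrans; first exact: (stieltjes_measure_itv vP (ltW rt)).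
rewrite (variation_fun_stop a r0) minxx.
by move/ltW/min_idPl : rt => ->; rewrite subrr.
Qed.

(* The right endpoint only adds the finite mass |h r| |da|{r}. *)
Lemma stieltjes_abs_integral_fin_left r : 0 <= r ->
  (\int[stieltjes_measure (variation_fun a)]_(s in `[0%R, r[) `|h s|%:E < +oo)%E ->
  (stieltjes_abs_integral h a r < +oo)%E.
Proof.
move=> r0 fr; rewrite (stieltjes_abs_integralE h aP r0).
have rE : `[0, r]%classic = `[0, r[%classic `|` [set r] :> set R.
  by rewrite setUitv1.
rewrite rE ge0_integral_setU//.
- rewrite lte_add_pinfty//; rewrite (@eq_integral _ _ _ _ _ (cst (h_abs r))).
    rewrite integral_cst// lte_mul_pinfty//.
    apply: (@le_lt_trans _ _ (stieltjes_measure (variation_fun a) `]r - 1, r]%classic)).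
      apply: le_measure; rewrite ?inE//.
      by move=> x ->; rewrite /= in_itv/= lexx andbT ltrBlDr ltrDl.
    have rr : r - 1 <= r by rewrite lerBlDr lerDl.
    by rewrite (stieltjes_measure_itv (variation_fun_distribution aP) rr) ltry.
  by move=> x; rewrite inE => ->.
- by rewrite -rE; exact: h_abs_itv.
- by apply/disj_setPS => x /= [] /[swap] ->; rewrite in_itv/= ltxx andbF.
Qed.

Lemma le_stieltjes_abs_integral_left r (M : \bar R) : 0 <= r -> (0 <= M)%E ->
  (forall u, 0 <= u -> u < r -> (stieltjes_abs_integral h a u <= M)%E) ->
  (\int[stieltjes_measure (variation_fun a)]_(s in `[0%R, r[) `|h s|%:E <= M)%E.
Proof.
rewrite le_eqVlt => /predU1P[<- M0 _|r0 M0 H].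
  by rewrite set_itv_ge ?integral_set0// bnd_simp ltxx.
pose muv := stieltjes_measure (variation_fun a) : {measure set TR -> \bar R}.
apply: (@le_integral_left _ muv h_abs h_abs0 mh_abs _ _ r0) => u u0 ur.
by rewrite -(stieltjes_abs_integralE h aP u0) H.
Qed.

Hypothesis fin : forall t, 0 <= t -> (stieltjes_abs_integral h a t < +oo)%E.

(** Since da^+ + da^- = |da|, each Jordan part is dominated by |da|, and integrability against |da|
    passes to both. *)
Let part_le (g : R -> R) (f : TR -> \bar R) t :
  (g = positive_part a \/ g = negative_part a) ->
  measurable_fun (`[0, +oo[%classic : set TR) f ->
  (forall s, 0 <= f s)%E -> (forall s, f s <= h_abs s)%E -> 0 <= t ->
  (\int[stieltjes_measure g]_(s in `[0%R, t]) f s < +oo)%E.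
Proof.
move=> gE mf f0 fh t0; apply: le_lt_trans (fin t0).
rewrite (stieltjes_abs_integralE h aP t0).
have mft : measurable_fun (`[0, t]%classic : set TR) f.
  apply: measurable_funS mf; first exact: measurableTypeR_itv.
  by move=> x /=; rewrite !in_itv/= andbT => /andP[].
have pP := positive_part_distribution aP.
have nP := negative_part_distribution aP.
pose mup := stieltjes_measure (positive_part a) : {measure set TR -> \bar R}.
pose mun := stieltjes_measure (negative_part a) : {measure set TR -> \bar R}.
apply: (@le_trans _ _ (\int[measure_add mup mun]_(s in `[0%R, t]) f s)%E).
  rewrite ge0_integral_measure_add//.
  by case: gE => ->; [apply: leeDl|apply: leeDr]; exact: integral_ge0.
apply: (@le_trans _ _ (\int[measure_add mup mun]_(s in `[0%R, t]) h_abs s)%E).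
  by apply: ge0_le_integral => //; exact: h_abs_itv.
rewrite le_eqVlt; apply/orP; left; apply/eqP; apply: eq_measure_integral => D mD _.
apply: etrans; first exact: measure_addE.
by rewrite -positive_negative_part; apply/esym/stieltjes_measureD.
Qed.

(** Splitting both h and da into positive and negative parts gives four finite integrals of
    nonnegative functions, each of them an [FV_path] in t. *)
Lemma FV_path_stieltjes_integral : FV_path (fun t => stieltjes_integral h a t).
Proof.
pose hE s : \bar R := (h s)%:E.
have mhE : measurable_fun (`[0, +oo[%classic : set TR) hE.
  exact/measurable_EFinP.
have hp0 s : (0 <= hE^\+ s)%E by exact: funepos_ge0.
have hn0 s : (0 <= hE^\- s)%E by exact: funeneg_ge0.
have mhp := measurable_funepos mhE.
have mhn := measurable_funeneg mhE.
have habs s : (hE^\+ s + hE^\- s)%E = h_abs s.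
  by have /(congr1 (fun k => k s)) := fune_abse hE.
have hp s : (hE^\+ s <= h_abs s)%E by rewrite -habs leeDl.
have hn s : (hE^\- s <= h_abs s)%E by rewrite -habs leeDr.
pose I g (f : TR -> \bar R) (t : R) :=
  fine (\int[stieltjes_measure g]_(s in `[0%R, t]) f s)%E.
have IP g f : (g = positive_part a \/ g = negative_part a) ->
    measurable_fun (`[0, +oo[%classic : set TR) f ->
    (forall s, 0 <= f s)%E -> (forall s, f s <= h_abs s)%E -> FV_path (I g f).
  move=> gE mf f0 fh; pose mu := stieltjes_measure g : {measure set TR -> \bar R}.
  by apply: (@FV_path_integral _ mu f f0 mf) => t t0; exact: (part_le gE mf f0 fh t0).
have RE g t : 0 <= t -> (g = positive_part a \/ g = negative_part a) ->
    Rintegral (stieltjes_measure g) `[0, t] h = I g hE^\+%E t - I g hE^\-%E t.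
  move=> t0 gE; rewrite /Rintegral integralE; apply: fineB.
  - rewrite ge0_fin_numE; last by apply: integral_ge0 => s _; exact: hp0.
    exact: (part_le gE mhp hp0 hp t0).
  - rewrite ge0_fin_numE; last by apply: integral_ge0 => s _; exact: hn0.
    exact: (part_le gE mhn hn0 hn t0).
have pE : positive_part a = positive_part a \/ positive_part a = negative_part a.
  by left.
have nE : negative_part a = positive_part a \/ negative_part a = negative_part a.
  by right.
apply: (@eq_FV_path _ ((I (positive_part a) hE^\+%E \+
  (\- I (positive_part a) hE^\-%E)) \+
  (\- (I (negative_part a) hE^\+%E \+ (\- I (negative_part a) hE^\-%E))))).
  move=> t t0; apply/esym; rewrite (stieltjes_integralE h aP t0).
  exact: (f_equal2 (fun x y : R => x - y) (RE _ _ t0 pE) (RE _ _ t0 nE)).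
have pp := IP _ _ pE mhp hp0 hp; have pn := IP _ _ pE mhn hn0 hn.
have np := IP _ _ nE mhp hp0 hp; have nn := IP _ _ nE mhn hn0 hn.
apply: FV_pathD; first exact: (FV_pathD pp (FV_pathN pn)).
exact: (FV_pathN (FV_pathD np (FV_pathN nn))).
Qed.

End integrand.

End stieltjes_integrals.

(** * Measurability of the integrals *)

Section stieltjes_kernel.
Context {R : realType} {d : measure_display} {X : measurableType d}.
Local Notation TR := (measurableTypeR R).
Variables (G : X -> R -> R) (t : R).
Hypothesis G_distribution : forall w, distribution_function (G w).
Hypothesis G_lt0 : forall w s, s < 0 -> G w s = 0.
Hypothesis G_ge : forall w s, t <= s -> G w s = G w t.
Hypothesis mG : forall s, measurable_fun [set: X] (fun w => G w s).

Let k (w : X) : {measure set TR -> \bar R} := stieltjes_measure (G w).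

Let k_itv w (x y : R) : x <= y -> k w `]x, y]%classic = (G w y - G w x)%:E.
Proof. by move=> xy; exact: (stieltjes_measure_itv (G_distribution w) xy). Qed.

(** [G w] vanishes before 0 and is constant after t, so the mass of []-n, n]] is eventually constant
    in n. *)
Let kT w : k w [set: TR] = (G w t)%:E.
Proof.
pose F n := `](- n%:R), n%:R]%classic : set TR.
have FT : \bigcup_n F n = [set: TR] by exact: (@bigcup_itvT R false false).
have mF n : measurable (F n) by exact: measurableTypeR_itv.
have kF : k w (F n) @[n --> \oo] --> k w [set: TR].
  rewrite -FT; apply: nondecreasing_cvg_mu => //.
    by rewrite FT.
  move=> m n mn; apply/subsetPset => x; rewrite /F /= !in_itv/= => /andP[mx xm].
  rewrite (le_trans xm) ?ler_nat// andbT (le_lt_trans _ mx)//.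
  by rewrite lerN2 ler_nat.
have : k w (F n) @[n --> \oo] --> (G w t)%:E.
  apply: cvg_near_cst; near=> n.
  have n0 : 0 < n%:R :> R by rewrite ltr0n; near: n; exact: nbhs_infty_gt.
  rewrite /F k_itv; last by rewrite ge0_cp// ltW.
  rewrite (@G_lt0 _ (- _)) ?oppr_lt0// subr0 G_ge//.
  by near: n; exact: nbhs_infty_ger.
by move/(cvg_unique _ kF); apply.
Unshelve. all: by end_near. Qed.

Let kfin w (U : set TR) : measurable U -> (k w U < +oo)%E.
Proof.
move=> mU; apply: (@le_lt_trans _ _ (k w [set: TR])); last by rewrite kT ltry.
by apply: le_measure; rewrite ?inE.
Qed.

(** Dynkin induction from the half-open intervals, whose mass is a difference of two values of G.
    The total mass [G w t] is finite, which lets complements through as differences. *)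
Lemma measurable_stieltjes_measure (U : set TR) : measurable U ->
  measurable_fun [set: X] (fun w => stieltjes_measure (G w) U).
Proof.
apply: (@dynkin_induction _ TR (@ocitv R)
  (fun U => measurable_fun [set: X] (fun w => k w U))) => //.
- exact: ocitvI.
- under eq_fun do rewrite kT.
  by apply/measurable_EFinP; exact: mG.
- move=> _ [[x y] _ <-] /=; have [xy|yx] := leP x y.
    under eq_fun do rewrite k_itv//.
    by apply/measurable_EFinP; apply: measurable_funB; exact: mG.
  under eq_fun do rewrite set_itv_ge ?measure0 ?bnd_simp -?leNgt ?ltW//.
  exact: measurable_cst.
- move=> S mS mkS.
  have -> : (fun w => k w (~` S)) = (fun w => (G w t)%:E - k w S)%E.
    by apply/funext => w; rewrite -kT -setTD measureD ?setTI//; exact: kfin.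
  by apply: emeasurable_funB => //; apply/measurable_EFinP; exact: mG.
- move=> F mF tF mkF.
  have -> : (fun w => k w (\bigcup_i F i)) = (fun w => \sum_(0 <= i <oo) k w (F i))%E.
    by apply/funext => w; rewrite measure_semi_bigcup//; exact: bigcup_measurable.
  by apply: ge0_emeasurable_sum => // i w _ _; exact: measure_ge0.
Qed.

Import HBNNSimple.

Lemma measurable_fun_stieltjes_integral (f : X * TR -> \bar R) :
  (forall z, 0 <= f z)%E -> measurable_fun [set: X * TR] f ->
  measurable_fun [set: X] (fun w => \int[stieltjes_measure (G w)]_s f (w, s))%E.
Proof.
move=> f0 mf; pose f_ := nnsfun_approx measurableT mf.
pose kk : R.-ker X ~> TR := HB.pack k
  (isKernel.Build _ _ _ _ _ k measurable_stieltjes_measure).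
apply: (@measurable_fun_xsection_integral _ _ _ _ _ f k f_).
- by move=> a b ab; exact/nd_nnsfun_approx.
- by move=> z; exact/cvg_nnsfun_approx.
move=> n r; set A := (f_ n @^-1` [set r]).
have mA : measurable A by exact: measurable_funPTI.
have := @measurable_prod_subset_xsection_kernel _ _ X TR R kk setT measurableT.
case/(_ _ A mA) => [w|_]; last first.
  by congr (measurable_fun _ _); apply/funext => w; rewrite /mrestr setIT.
(* The bound on the measures has to be strict, hence the + 1. *)
exists (G w t + 1) => U mU; apply: (@le_lt_trans _ _ (k w [set: TR])).
  by rewrite /mrestr; apply: le_measure; rewrite ?inE//; exact: measurableI.
by rewrite kT lte_fin ltrDl.
Qed.

End stieltjes_kernel.

(** * Grids, and total variation as a limit along them *)

Section right_grid.
Context {R : realType}.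
Implicit Types (a : R -> R) (s t : R) (n : nat).

(** Index of the first multiple of 1/(n+1) strictly to the right of s; strictness is what limits
    from the right require. *)
Definition grid_index n s : nat := (Num.trunc (s * n.+1%:R)).+1.

(** The cap keeps all sampling times in [[0, t]], so that samples of an adapted process are
    measurable at time t. *)
Definition grid_point t n (i : nat) : R := Num.min t (i%:R / n.+1%:R).

Lemma grid_index_gt n s : s < (grid_index n s)%:R / n.+1%:R.
Proof. by rewrite ltr_pdivlMr ?ltr0n// -truncn_le_nat. Qed.

Lemma grid_index_le n s : 0 <= s ->
  (grid_index n s)%:R / n.+1%:R <= s + n.+1%:R^-1.
Proof.
move=> s0; rewrite ler_pdivrMr ?ltr0n// mulrDl mulVf ?pnatr_eq0//.
by rewrite /grid_index -natr1 lerD2r truncn_le mulr_ge0.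
Qed.

Lemma le_grid_index n : {homo grid_index n : x y / x <= y >-> (x <= y)%N}.
Proof. by move=> x y xy; rewrite ltnS le_truncn// ler_wpM2r. Qed.

Lemma cvg_grid_point a t s : 0 <= s <= t -> a x @[x --> s^'+] --> a s ->
  a (grid_point t n (grid_index n s)) @[n --> \oo] --> a s.
Proof.
(* At s = t the cap makes the sequence constant; for s < t it approaches s strictly from the
   right. *)
move=> /andP[s0]; rewrite le_eqVlt => /predU1P[-> _|st].
  apply: cvg_near_cst; near=> n; rewrite /grid_point.
  by have /ltW/min_idPl -> := grid_index_gt n t.
move=> /cvg_at_rightP; apply; split.
  by move=> n; rewrite /grid_point lt_min st grid_index_gt.
apply: (@squeeze_cvgr _ _ _ _ (cst s) (fun n => s + harmonic n)).
- apply: nearW => n; rewrite /grid_point le_min (ltW st) ltW ?grid_index_gt//=.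
  by rewrite ge_min grid_index_le// orbT.
- exact: cvg_cst.
- by rewrite -[X in _ --> X]addr0; apply: cvgD; [exact: cvg_cst|exact: cvg_harmonic].
Unshelve. all: by end_near. Qed.

Definition grid_variation a t n (m : nat) : R :=
  \sum_(i < m) `|a (grid_point t n i.+1) - a (grid_point t n i)|.

Lemma grid_point_ge0 t n i : 0 <= t -> 0 <= grid_point t n i.
Proof. by move=> t0; rewrite /grid_point le_min t0 divr_ge0. Qed.

Lemma grid_pointS t n i : grid_point t n i <= grid_point t n i.+1.
Proof.
rewrite /grid_point le_min ge_min lexx/= ge_min ler_pM2r ?invr_gt0 ?ltr0n//.
by rewrite ler_nat leqnSn orbT.
Qed.

Lemma grid_variation_le a t n m : 0 <= t ->
  ((grid_variation a t n m)%:E <= total_variation 0 t a)%E.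
Proof.
move=> t0.
apply: (@le_trans _ _ (total_variation 0 (grid_point t n m) a)); last first.
  apply: (@total_variation_nondecreasing _ _ t); rewrite ?in_itv/= ?t0 ?lexx//.
    by rewrite grid_point_ge0//= /grid_point ge_min lexx.
  by rewrite /grid_point ge_min lexx.
elim: m => [|m IH].
  by rewrite /grid_variation big_ord0 total_variation_ge0// grid_point_ge0.
rewrite /grid_variation big_ord_recr /= EFinD.
rewrite (total_variationD _ (grid_point_ge0 n m t0) (grid_pointS t n m)).
by apply: leeD => //; exact/total_variation_ge/grid_pointS.
Qed.

Lemma grid_variationB a t n (i j : nat) : (i <= j)%N ->
  `|a (grid_point t n j) - a (grid_point t n i)| <=
  grid_variation a t n j - grid_variation a t n i.
Proof.
move=> /subnK <-; elim: (j - i)%N => [|m IH]; first by rewrite !subrr normr0.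
rewrite addSn {1}/grid_variation big_ord_recr/= -/(grid_variation _ _ _ _).
set u := a (grid_point t n (m + i).+1); set v := a (grid_point t n (m + i)).
set x := a (grid_point t n i) in IH *.
by move: IH (ler_distD v u x) => /=; lra.
Qed.

Lemma cvg_sum_ord (N : nat) (f : nat -> nat -> R) (l : nat -> R) :
  (forall m, (m < N)%N -> f m n @[n --> \oo] --> l m) ->
  \sum_(m < N) f m n @[n --> \oo] --> \sum_(m < N) l m.
Proof.
elim: N => [|N IH] H.
  by rewrite big_ord0; under eq_fun do rewrite big_ord0; exact: cvg_cst.
rewrite big_ord_recr; under eq_fun do rewrite big_ord_recr.
apply: cvgD; last exact: H.
by apply: IH => m mN; apply: H; rewrite ltnW// ltnS.
Qed.

(* The points of a partition can be moved to grid points on their right, which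
   changes its variation by little since a is right-continuous. *)
Lemma cvg_grid_variation a t : 0 <= t -> FV_path a ->
  grid_variation a t n (grid_index n t) @[n --> \oo] -->
  fine (total_variation 0 t a).
Proof.
move=> t0 aP; have tfin := total_variation_fin aP t0.
apply/cvgrPdist_le => e e0.
have : (total_variation 0 t a - e%:E < total_variation 0 t a)%E.
  by rewrite -(fineK tfin) -EFinB lte_fin ltrBlDr ltrDl.
move=> /ereal_sup_gt[_ [_ [l lP <-] <-]].
rewrite -{1}(fineK tfin) -EFinB lte_fin => Hl.
set F := a \o nth t (0 :: l) in Hl.
pose y m := nth t (0 :: l) m.
have yP m : (m < (size l).+1)%N -> 0 <= y m <= t.
  by move=> ml; rewrite (itv_partition_nth_ge ml lP) (itv_partition_nth_le ml lP).
have ynd m : (m < size l)%N -> y m <= y m.+1.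
  move=> ml; case: lP => /(pathP t)/(_ _ ml) /ltW + _.
  by [].
pose V n := \sum_(m < size l)
  `|a (grid_point t n (grid_index n (y m.+1))) -
    a (grid_point t n (grid_index n (y m)))|.
have cV : V n @[n --> \oo] --> variation 0 t a l.
  rewrite /variation big_mkord.
  apply: (@cvg_sum_ord (size l)
    (fun m n => `|a (grid_point t n (grid_index n (y m.+1))) -
                  a (grid_point t n (grid_index n (y m)))|)
    (fun m => `|F m.+1 - F m|)) => m ml; apply: cvg_norm; apply: cvgB.
    apply: cvg_grid_point; first exact: yP.
    have /andP[ym0 _] : 0 <= y m.+1 <= t by exact: yP.
    by case: aP => /(_ _ ym0)[].
  have ml' : (m < (size l).+1)%N by rewrite ltnW// ltnS.
  apply: cvg_grid_point; first exact: yP.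
  have /andP[ym0 _] : 0 <= y m <= t by exact: yP.
  by case: aP => /(_ _ ym0)[].
(* Moving partition points to the grid preserves their order, so each increment is bounded by the
   grid variation in between, and these bounds telescope. *)
have VD n : V n <= grid_variation a t n (grid_index n t).
  pose S i := grid_variation a t n (grid_index n (y i)).
  apply: (@le_trans _ _ (\sum_(m < size l) (S m.+1 - S m))).
    by apply: ler_sum => i _; apply: grid_variationB; apply: le_grid_index; exact: ynd.
  rewrite -(big_mkord xpredT (fun m => S m.+1 - S m)) telescope_sumr//.
  have -> : S (size l) = grid_variation a t n (grid_index n t).
    by rewrite /S /y (itv_partition_nth_size t lP).
  by rewrite lerBlDr lerDl sumr_ge0.
near=> n.
have Dn : grid_variation a t n (grid_index n t) <= fine (total_variation 0 t a).
  by rewrite -lee_fin fineK// grid_variation_le.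
rewrite ger0_norm ?subr_ge0// lerBlDr -lerBlDl.
apply: (le_trans _ (VD n)); apply: ltW; near: n.
exact: (cvgr_gt _ cV).
Unshelve. all: by end_near. Qed.

End right_grid.

Section measurable_paths.
Context {R : realType} {d : measure_display} {X : measurableType d}.
Variables (a : X -> R -> R) (t : R).
Hypothesis aP : forall w, FV_path (a w).
Hypothesis ma : forall s, 0 <= s <= t -> measurable_fun [set: X] (fun w => a w s).
Hypothesis t0 : 0 <= t.

Let mV s : 0 <= s <= t ->
  measurable_fun [set: X] (fun w => variation_fun (a w) s).
Proof.
move=> /andP[s0 st]; under eq_fun do rewrite variation_funE /cut_at0 s0.
apply: measurable_funD.
  by apply: measurableT_comp => //; apply: ma; rewrite lexx.
apply: (@measurable_fun_cvg _ _ _ _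
  (fun n w => grid_variation (a w) s n (grid_index n s))).
  move=> n; apply: measurable_sum => i; apply: measurableT_comp => //.
  have H j : 0 <= grid_point s n j <= t.
    by rewrite grid_point_ge0//= (le_trans _ st)// /grid_point ge_min lexx.
  by apply: measurable_funB; exact: ma.
by move=> w _; exact: cvg_grid_variation.
Qed.

Lemma measurable_variation_fun_stop s :
  measurable_fun [set: X] (fun w => variation_fun (stop_path (a w) t) s).
Proof.
under eq_fun do rewrite (variation_fun_stop _ t0).
have [s0|s0] := leP 0 s; first by apply: mV; rewrite le_min t0 s0 ge_min lexx.
under eq_fun do rewrite variation_funE /cut_at0 le_min t0/= leNgt s0/=.
exact: measurable_cst.
Qed.

Lemma measurable_positive_part_stop s :
  measurable_fun [set: X] (fun w => positive_part (stop_path (a w) t) s).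
Proof.
under eq_fun do rewrite (positive_part_stop _ t0) positive_partE /cut_at0 le_min t0/=.
have [s0|s0] := boolP (0 <= s); last exact: measurable_cst.
have st : 0 <= Num.min t s <= t by rewrite le_min t0 s0 ge_min lexx.
by apply: measurable_funM => //; apply: measurable_funD; [exact: mV|exact: ma].
Qed.

Lemma measurable_negative_part_stop s :
  measurable_fun [set: X] (fun w => negative_part (stop_path (a w) t) s).
Proof.
under eq_fun do rewrite (negative_part_stop _ t0) negative_partE /cut_at0 le_min t0/=.
have [s0|s0] := boolP (0 <= s); last exact: measurable_cst.
have st : 0 <= Num.min t s <= t by rewrite le_min t0 s0 ge_min lexx.
by apply: measurable_funM => //; apply: measurable_funB; [exact: mV|exact: ma].
Qed.

End measurable_paths.

(* The hypothesis on i is stated with <= because on the grids i is a truncation. *)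
Lemma measurable_fun_glue {R : realType} d (T : measurableType d) (D : set T)
    (f : nat -> T -> R) (i : T -> nat) :
  measurable D ->
  (forall k, measurable_fun D (f k)) ->
  (forall k, measurable (D `&` [set z | (i z <= k)%N])) ->
  measurable_fun D (fun z => f (i z) z).
Proof.
move=> mD mf mi; pose E k := D `&` [set z | i z = k].
have -> : D = \bigcup_k E k.
  by apply/seteqP; split=> [z Dz|z [k _ []]//]; exists (i z).
have mE k : measurable (E k).
  have -> : E k = (D `&` [set z | (i z <= k)%N]) `\`
      (if k is k'.+1 then D `&` [set z | (i z <= k')%N] else set0).
    apply/seteqP; split=> z /=.
      move=> [Dz izk]; split; first by split=> //=; rewrite izk.
      by case: k izk => [_ []|k izk [_ /=]]; rewrite izk ltnn.
    move=> [[Dz izk] H]; split=> //=; apply/eqP; rewrite eqn_leq izk/=.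
    by case: k izk H => // k izk H; rewrite ltnNge; apply/negP => ik; apply: H.
  by apply: measurableD => //; case: k => [|k].
apply/measurable_fun_bigcup => // k.
apply: (@eq_measurable_fun _ _ _ _ _ (f k)).
  by move=> z; rewrite inE => -[_ <-].
by apply: measurable_funS (mf k) => // z [].
Qed.

Lemma measurable_fun_sublevel {R : realType} d (T : measurableType d) (f : T -> R) :
  (forall c, measurable [set w | f w <= c]) -> measurable_fun [set: T] f.
Proof.
move=> mf; apply: (measurability (@RGenInftyO.G R)).
  exact: RGenInftyO.measurableE.
move=> _ [_ [x ->] <-]; rewrite setTI.
have -> : f @^-1` `]-oo, x[%classic = \bigcup_n [set w | f w <= x - n.+1%:R^-1].
  apply/seteqP; split=> w /=.
    rewrite in_itv/= => /ltr_add_invr[n fwx]; exists n => //=.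
    by rewrite lerBrDr ltW.
  by move=> [n _ /= fw]; rewrite in_itv/= (le_lt_trans fw)// ltrBlDr ltrDl.
exact: bigcup_measurable.
Qed.

(** * Predictable processes are progressive *)

Section filtered_processes.
Context {R : realType} {d : measure_display} {Om : measurableType d}.
Variables (P : probability Om R) (F : R -> set (set Om)).
Hypothesis hF : usual_conditions P F.
Local Notation TR := (measurableTypeR R).
Local Notation Ft t := (g_sigma_algebraType (F t)).
Implicit Types (X H A : Om * R -> R) (t s : R).

Lemma measurable_filtrationE t (D : set Om) : 0 <= t ->
  measurable (D : set (Ft t)) <-> F t D.
Proof.
move=> t0; split=> [|FD]; last exact: sub_sigma_algebra.
apply: smallest_sub; last exact: subset_refl.
exact: (filtration_sigma_algebra hF).
Qed.

Lemma adapted_measurable X s t : adapted F X -> 0 <= s -> s <= t ->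
  measurable_fun [set: Ft t] (fun w => X (w, s)).
Proof.
move=> aX s0 st mT Y mY; rewrite setTI.
have /(_ measurableT _ mY) := aX s s0; rewrite setTI.
move/(measurable_filtrationE _ s0)/(filtration_increasing hF s0 st).
by apply: sub_sigma_algebra.
Qed.

(* The grid point below t may be t itself, which is harmless. *)
Lemma left_continuous_grid (a : R -> R) t : 0 <= t -> left_continuous_path a ->
  a (grid_point t n (Num.trunc (t * n.+1%:R))) @[n --> \oo] --> a t.
Proof.
rewrite le_eqVlt => /predU1P[<- _|t_gt0 ca].
  apply: cvg_near_cst; apply: nearW => n.
  by rewrite /grid_point mul0r truncn0 mul0r minxx.
pose u n := (Num.trunc (t * n.+1%:R))%:R / n.+1%:R : R.
have ut n : u n <= t by rewrite ler_pdivrMr ?ltr0n// truncn_le mulr_ge0// ltW.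
have uE n : grid_point t n (Num.trunc (t * n.+1%:R)) = u n.
  by rewrite /grid_point; apply/min_idPr; exact: ut.
under eq_fun do rewrite uE.
have cu : u n @[n --> \oo] --> t.
  apply: (@squeeze_cvgr _ _ _ _ (fun n => t - harmonic n) (cst t)).
  - apply: nearW => n; rewrite ut andbT lerBlDr.
    by have /ltW := grid_index_gt n t; rewrite /grid_index -natr1 mulrDl mul1r.
  - by rewrite -[X in _ --> X]subr0; apply: cvgB; [exact: cvg_cst|exact: cvg_harmonic].
  - exact: cvg_cst.
apply/cvgrPdist_le => e e0.
have /cvgrPdist_le/(_ e e0) := ca t t_gt0.
move=> [dl /= dl0 H].
have /cvgrPdist_lt/(_ dl dl0) := cu; apply: filterS => n /= tu.
have := ut n; rewrite le_eqVlt => /predU1P[->|un].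
  by rewrite subrr normr0 ltW.
exact: H.
Qed.

(** Sampling X at the last grid point up to s gives step processes that use only times at most t,
    hence are jointly measurable with respect to F_t. Left-continuity makes them converge to X. *)
Lemma left_continuous_progressive X t : 0 <= t -> adapted F X ->
  (forall w, left_continuous_path (fun s => X (w, s))) ->
  measurable_fun ([set: Ft t] `*` `[0%R, t]%classic : set (Ft t * TR)) X.
Proof.
move=> t0 aX cX; set D := [set: Ft t] `*` _.
have mD : measurable D by apply: measurableX => //; exact: measurableTypeR_itv.
pose h n (z : Ft t * TR) := X (z.1, grid_point t n (Num.trunc (z.2 * n.+1%:R))).
apply: (@measurable_fun_cvg _ _ R D h (X : Ft t * TR -> R)).
  move=> n; apply: (@measurable_fun_glue _ _ _ _
      (fun i (z : Ft t * TR) => X (z.1, grid_point t n i))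
      (fun z => Num.trunc (z.2 * n.+1%:R))) => //.
    move=> k; apply: measurable_funTS.
    apply: (@measurableT_comp _ _ _ _ _ _ (fun w : Ft t => X (w, _))) => //.
    apply: adapted_measurable => //; first exact: grid_point_ge0.
    by rewrite /grid_point ge_min lexx.
  move=> k; pose c : R := k.+1%:R / n.+1%:R.
  have -> : D `&` [set z | (Num.trunc (z.2 * n.+1%:R) <= k)%N] =
      [set: Ft t] `*` (`[0%R, t]%classic `&` `]-oo, c[%classic : set TR).
    apply/seteqP; split=> -[w s] /=; rewrite !in_itv/= truncn_le_nat /c.
      by move=> [[_ st] sk]; rewrite ltr_pdivlMr ?ltr0n.
    by rewrite ltr_pdivlMr ?ltr0n// => -[_ [st sk]].
  by apply: measurableX => //; apply: measurableI; exact: measurableTypeR_itv.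
move=> [w s] [_ /=]; rewrite in_itv/= => /andP[s0 st].
have := left_continuous_grid s0 (cX w).
apply: cvg_trans; apply: near_eq_cvg; apply: nearW => n.
rewrite /h /grid_point /=.
have snE : (Num.trunc (s * n.+1%:R))%:R / n.+1%:R <= s.
  by rewrite ler_pdivrMr ?ltr0n// truncn_le mulr_ge0.
by rewrite (min_idPr snE) (min_idPr (le_trans snE st)).
Qed.

Lemma predictable_time_domain :
  measurable (time_domain : set (g_sigma_algebraType (predictable_generator F))).
Proof.
apply: sub_sigma_algebra; exists (cst 0) => /=.
  split=> [s s0|w s s0]; first exact: measurable_cst.
  exact: cvg_cst.
by exists setT => //; rewrite preimage_setT setIT.
Qed.

(** Good-sets argument: the sets with measurable trace on D form a sigma-algebra, and the
    left-continuous case puts the generators into it. *)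
Lemma predictable_progressive H t : 0 <= t -> predictable_process F H ->
  measurable_fun ([set: Ft t] `*` `[0%R, t]%classic : set (Ft t * TR)) H.
Proof.
move=> t0 pH; set D := [set: Ft t] `*` _.
have mD : measurable D by apply: measurableX => //; exact: measurableTypeR_itv.
pose S := [set C : set (Ft t * TR) | measurable (D `&` C)].
have S_sigma : sigma_algebra setT S.
  split; first by rewrite /S/= setI0.
    move=> C; rewrite /S/= => mC.
    by rewrite setTD -setDE -[D `\` C]set0U -(setDv D) -setDIr; exact: measurableD.
  by move=> C mC; rewrite /S/= setI_bigcupr; apply: bigcup_measurable => k _; exact: mC.
have DT : D `<=` (time_domain : set (Om * R)).
  move=> [w s] [_ /=]; rewrite in_itv/= => /andP[s0 _].
  by split=> //=; rewrite in_itv/= s0.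
have S_gen : predictable_generator F `<=` S.
  move=> C [X [aX cX] [Y mY <-]]; rewrite /S/= setIA (setIidl DT).
  exact: left_continuous_progressive.
move=> _ Y mY.
suff : <<s predictable_generator F >> `<=` S.
  move=> /(_ (time_domain `&` H @^-1` Y)).
  rewrite /S/= setIA (setIidl DT); apply.
  by apply: pH => //; exact: predictable_time_domain.
exact: smallest_sub.
Qed.

End filtered_processes.

(** * Adaptedness of pathwise integrals *)

Section path_integrals.
Context {R : realType} {d : measure_display} {Om : measurableType d}.
Variables (P : probability Om R) (F : R -> set (set Om)).
Hypothesis hF : usual_conditions P F.
Local Notation TR := (measurableTypeR R).
Local Notation Ft t := (g_sigma_algebraType (F t)).
Implicit Types (X H A : Om * R -> R) (t s : R).

Lemma predictable_path H w : predictable_process F H ->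
  measurable_fun (`[0%R, +oo[%classic : set TR) (fun s => H (w, s)).
Proof.
move=> pH; rewrite itv0y_bigcup0S; apply/measurable_fun_bigcup => n.
  exact: measurableTypeR_itv.
have n0 : 0 <= n.+1%:R :> R by [].
have mH := predictable_progressive hF n0 pH.
rewrite -[X in measurable_fun _ X]/(H \o (fun s : TR => ((w : Ft n.+1%:R), s))).
apply: (measurable_comp _ _ mH).
- by apply: measurableX => //; exact: measurableTypeR_itv.
- by move=> _ [s sn <-].
- by apply: measurable_funTS; exact: pair1_measurable.
Qed.

Lemma FV_process_path A w : FV_process F A -> FV_path (fun s => A (w, s)).
Proof. by case=> _ /(_ w). Qed.

(** Here [g] stands for any of [variation_fun], [positive_part] and [negative_part]. Extending f by
    0 outside [[0, t]] reduces the claim to the kernel on the whole line. *)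
Lemma measurable_path_integral (g : (R -> R) -> R -> R) A t (f : Om * R -> \bar R) :
  0 <= t -> FV_process F A ->
  (forall a, FV_path a -> distribution_function (g a)) ->
  (forall a s, s < 0 -> g a s = 0) ->
  (forall a, g (stop_path a t) = (fun s => g a (Num.min t s))) ->
  (forall s, measurable_fun [set: Ft t]
    (fun w => g (stop_path (fun s => A (w, s)) t) s)) ->
  (forall z, 0 <= f z)%E ->
  measurable_fun ([set: Ft t] `*` `[0%R, t]%classic : set (Ft t * TR)) f ->
  measurable_fun [set: Ft t] (fun w =>
    \int[stieltjes_measure (g (stop_path (fun s => A (w, s)) t))]_(s in `[0%R, t])
      f (w, s))%E.
Proof.
move=> t0 AP gP g_lt0 g_stop mg f0 mf; set D := [set: Ft t] `*` _ in mf.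
have mD : measurable D by apply: measurableX => //; exact: measurableTypeR_itv.
pose G (w : Ft t) := g (stop_path (fun s => A (w, s)) t).
have GP w : distribution_function (G w).
  by apply: gP; apply: FV_path_stop => //; exact: FV_process_path.
have G_lt0 w s : s < 0 -> G w s = 0 by exact: g_lt0.
have G_ge w s : t <= s -> G w s = G w t.
  by move=> ts; rewrite /G g_stop (min_idPl ts) minxx.
have f0' z : (0 <= (f \_ D) z)%E by rewrite patchE; case: ifPn.
have mf' : measurable_fun [set: Ft t * TR] (f \_ D).
  exact/(measurable_restrictT _ mD).
have := measurable_fun_stieltjes_integral GP G_lt0 G_ge mg f0' mf'.
congr (measurable_fun _ _); apply/funext => w.
rewrite [RHS]integral_mkcond; apply: eq_integral => s _.
by rewrite !patchE /D in_setX in_setT.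
Qed.

Lemma measurable_stieltjes_abs_integral H A t : 0 <= t ->
  predictable_process F H -> FV_process F A ->
  measurable_fun [set: Ft t] (fun w => stieltjes_abs_integral
    (fun s => H (w, s)) (fun s => A (w, s)) t).
Proof.
move=> t0 pH AP.
apply: (@measurable_path_integral variation_fun A t (fun z => `|H z|%:E)) => //.
- exact: variation_fun_distribution.
- by move=> a s s0; rewrite variation_funE /cut_at0 leNgt s0.
- by move=> a; exact: variation_fun_stop.
- move=> s; apply: measurable_variation_fun_stop => //.
    by move=> w; exact: FV_process_path.
  by move=> u /andP[u0 ut]; apply: (adapted_measurable hF) => //; case: AP.
- apply/measurable_EFinP; apply: measurableT_comp => //.
  exact: (predictable_progressive hF).
Qed.

(** The integrals of H^+ and H^- are subtracted in the extended reals and [fine] is applied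
    afterwards. Paths with infinite integrals thus get a junk value that is still measurable in
    w. *)
Lemma measurable_Rintegral_path (g : (R -> R) -> R -> R) H A t :
  0 <= t -> predictable_process F H -> FV_process F A ->
  (forall a, FV_path a -> distribution_function (g a)) ->
  (forall a s, s < 0 -> g a s = 0) ->
  (forall a, g (stop_path a t) = (fun s => g a (Num.min t s))) ->
  (forall s, measurable_fun [set: Ft t]
    (fun w => g (stop_path (fun s => A (w, s)) t) s)) ->
  measurable_fun [set: Ft t] (fun w =>
    Rintegral (stieltjes_measure (g (stop_path (fun s => A (w, s)) t)))
      `[0, t] (fun s => H (w, s))).
Proof.
move=> t0 pH AP gP g_lt0 g_stop mg.
have mH := predictable_progressive hF t0 pH.
have mHE : measurable_fun
    ([set: Ft t] `*` `[0%R, t]%classic : set (Ft t * TR)) (EFin \o H).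
  exact/measurable_EFinP.
have mp := measurable_path_integral t0 AP gP g_lt0 g_stop mg
  (funepos_ge0 (EFin \o H)) (measurable_funepos mHE).
have mn := measurable_path_integral t0 AP gP g_lt0 g_stop mg
  (funeneg_ge0 (EFin \o H)) (measurable_funeneg mHE).
apply: (@measurableT_comp _ _ _ _ _ _ fine) => //.
have := emeasurable_funB mp mn.
congr (measurable_fun _ _); apply/funext => w; rewrite [RHS]integralE.
apply: (f_equal2 (fun x y : \bar R => x - y)%E); apply: eq_integral => s _.
  by rewrite !funeposE.
by rewrite !funenegE.
Qed.

Lemma measurable_stieltjes_integral H A t : 0 <= t ->
  predictable_process F H -> FV_process F A ->
  measurable_fun [set: Ft t] (fun w => stieltjes_integral
    (fun s => H (w, s)) (fun s => A (w, s)) t).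
Proof.
move=> t0 pH AP.
have Apath w : FV_path (fun s => A (w, s)) by exact: FV_process_path.
have mA u : 0 <= u <= t -> measurable_fun [set: Ft t] (fun w => A (w, u)).
  by move=> /andP[u0 ut]; apply: (adapted_measurable hF) => //; case: AP.
apply: measurable_funB.
- apply: (measurable_Rintegral_path t0 pH AP).
  + exact: positive_part_distribution.
  + by move=> a s s0; rewrite positive_partE /cut_at0 leNgt s0.
  + by move=> a; exact: positive_part_stop.
  + by move=> s; exact: measurable_positive_part_stop.
- apply: (measurable_Rintegral_path t0 pH AP).
  + exact: negative_part_distribution.
  + by move=> a s s0; rewrite negative_partE /cut_at0 leNgt s0.
  + by move=> a; exact: negative_part_stop.
  + by move=> s; exact: measurable_negative_part_stop.
Qed.

End path_integrals.

(** * Stopping and gluing processes *)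

Section stopping_times.
Context {R : realType} {d : measure_display} {Om : measurableType d}.
Variables (P : probability Om R) (F : R -> set (set Om)).
Hypothesis hF : usual_conditions P F.
Local Notation Ft t := (g_sigma_algebraType (F t)).
Implicit Types (X H A : Om * R -> R) (t s : R) (tau : Om -> \bar R).

Lemma filtration_bigcup t (D : nat -> set Om) : 0 <= t ->
  (forall n, F t (D n)) -> F t (\bigcup_n D n).
Proof. by move=> t0 FD; have [_ _] := filtration_sigma_algebra hF t0; exact. Qed.

Lemma filtrationC t (D : set Om) : 0 <= t -> F t D -> F t (~` D).
Proof.
by move=> t0 FD; have [_ + _] := filtration_sigma_algebra hF t0; rewrite -setTD; exact.
Qed.

Lemma filtration_bigcap t (D : nat -> set Om) : 0 <= t ->
  (forall n, F t (D n)) -> F t (\bigcap_n D n).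
Proof.
move=> t0 FD; rewrite -[X in F t X]setCK setC_bigcap; apply: filtrationC => //.
by apply: filtration_bigcup => // n; exact: filtrationC.
Qed.

Lemma filtrationU t (D E : set Om) : 0 <= t -> F t D -> F t E -> F t (D `|` E).
Proof.
move=> t0 /(measurable_filtrationE hF _ t0) mD /(measurable_filtrationE hF _ t0) mE.
by apply/(measurable_filtrationE hF _ t0); exact: measurableU.
Qed.

Lemma filtrationI t (D E : set Om) : 0 <= t -> F t D -> F t E -> F t (D `&` E).
Proof.
move=> t0 /(measurable_filtrationE hF _ t0) mD /(measurable_filtrationE hF _ t0) mE.
by apply/(measurable_filtrationE hF _ t0); exact: measurableI.
Qed.

Lemma filtration_negligible t (N : set Om) : 0 <= t -> P.-negligible N -> F t N.
Proof.
move=> t0 PN; apply: (filtration_increasing hF (lexx 0) t0).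
exact: (filtration_complete hF).
Qed.

Lemma stopping_time_lt tau t : stopping_time F tau -> 0 <= t ->
  F t [set w | (tau w < t%:E)%E].
Proof.
move=> [tau0 Ftau] t0.
have -> : [set w | (tau w < t%:E)%E] =
    \bigcup_n [set w | (tau w <= (t - n.+1%:R^-1)%:E)%E].
  apply/seteqP; split=> w /=.
    move: (tau0 w); case E : (tau w) => [r| |]//= r0.
    rewrite lte_fin => /ltr_add_invr[n rt].
    by exists n => //=; rewrite E lee_fin lerBrDr ltW.
  by move=> [n _ /= /le_lt_trans]; apply; rewrite lte_fin ltrBlDr ltrDl.
apply: filtration_bigcup => // n.
have [tn|tn] := leP 0 (t - n.+1%:R^-1).
  apply: (filtration_increasing hF tn) (Ftau _ tn).
  by rewrite lerBlDr lerDl.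
rewrite [X in F t X](_ : _ = set0).
  by have [] := filtration_sigma_algebra hF t0.
apply/seteqP; split=> // w /= /(le_trans (tau0 w)).
by rewrite lee_fin leNgt tn.
Qed.

Definition hitting_time (V : R -> Om -> \bar R) (c : \bar R) : Om -> \bar R :=
  fun w => ereal_inf [set t%:E | t in [set t | 0 <= t /\ (c <= V t w)%E]].

(* V need not be right-continuous: it may jump to +oo immediately after the
   hitting time. The right-continuity of the filtration suffices. *)
Lemma hitting_time_stopping V c :
  (forall s t w, 0 <= s -> s <= t -> (V s w <= V t w)%E) ->
  (forall t, 0 <= t -> measurable_fun [set: Ft t] (V t)) ->
  stopping_time F (hitting_time V c).
Proof.
move=> V_nd mV; split=> [w|t t0].
  by apply: le_ereal_inf_tmp => _ [t [t0 _] <-]; rewrite lee_fin.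
rewrite -(filtration_right_continuous hF t0) => s /=; rewrite in_itv/= andbT => ts.
have s0 : 0 <= s by rewrite (le_trans t0)// ltW.
(* A sequence decreasing to t inside []t, s]]. As V is nondecreasing, the hitting time is at most t
   exactly when V has reached c at every [u n], and all these events lie in F_s. *)
pose u n := t + (s - t) / n.+1%:R.
have st0 : 0 < s - t by rewrite subr_gt0.
have tu n : t < u n by rewrite ltrDl divr_gt0.
have u0 n : 0 <= u n by rewrite (le_trans t0)// ltW.
have us n : u n <= s.
  by rewrite -lerBrDl ler_pdivrMr ?ltr0n// ler_peMr ?ler1n// ltW.
have -> : [set w | (hitting_time V c w <= t%:E)%E] =
    \bigcap_n [set w | (c <= V (u n) w)%E].
  apply/seteqP; split=> w /=.
    move=> wt n _ /=.
    have : (hitting_time V c w < (u n)%:E)%E by rewrite (le_lt_trans wt)// lte_fin.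
    move=> /ereal_inf_lt[_ [v [v0 cv] <-]]; rewrite lte_fin => /ltW vu.
    exact: le_trans cv (V_nd _ _ _ v0 vu).
  move=> H; apply/lee_addgt0Pr => e e0.
  have [n nP] : exists n, u n <= t + e.
    exists (Num.trunc ((s - t) / e)); rewrite lerD2l ler_pdivrMr ?ltr0n//.
    by rewrite -ler_pdivrMl// mulrC ltW// -truncn_le_nat.
  have /= Hn := H n I.
  apply: (@le_trans _ _ (u n)%:E); last by rewrite -EFinD lee_fin.
  by apply: ereal_inf_lbound; exists (u n).
apply: filtration_bigcap => // n.
apply: (filtration_increasing hF (u0 n) (us n)).
apply/(measurable_filtrationE hF _ (u0 n)).
rewrite -[X in measurable X]setTI; apply: emeasurable_fun_c_infty => //.
exact: mV.
Qed.

Lemma lt_hitting_time V c w t : 0 <= t -> (t%:E < hitting_time V c w)%E ->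
  (V t w < c)%E.
Proof.
move=> t0; rewrite !ltNge; apply: contra => cV.
by apply: ereal_inf_lbound; exists t.
Qed.

Lemma le_hitting_time V c w t :
  (forall s, 0 <= s -> s < t -> (V s w < c)%E) -> (t%:E <= hitting_time V c w)%E.
Proof.
move=> H; apply: le_ereal_inf_tmp => _ [s [s0 cV] <-]; rewrite lee_fin leNgt.
by apply/negP => st; have := H _ s0 st; rewrite ltNge cV.
Qed.

Lemma stopping_time_min tau tau' : stopping_time F tau -> stopping_time F tau' ->
  stopping_time F (fun w => Order.min (tau w) (tau' w)).
Proof.
move=> [tau0 Ftau] [tau'0 Ftau']; split=> [w|t t0]; first by rewrite le_min tau0 tau'0.
have -> : [set w | (Order.min (tau w) (tau' w) <= t%:E)%E] =
    [set w | (tau w <= t%:E)%E] `|` [set w | (tau' w <= t%:E)%E].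
  by apply/seteqP; split=> w /=; rewrite ge_min => /orP.
by apply: filtrationU => //; [exact: Ftau|exact: Ftau'].
Qed.

(** Completeness puts N into every [F t], so a stopping time may be exchanged for another one on a
    null set. *)
Lemma stopping_time_negligible (N : set Om) tau tau' : P.-negligible N ->
  stopping_time F tau -> stopping_time F tau' ->
  stopping_time F (fun w => if w \in N then tau w else tau' w).
Proof.
move=> PN [tau0 Ftau] [tau'0 Ftau']; split=> [w|t t0]; first by case: ifPn.
have -> : [set w | ((if w \in N then tau w else tau' w) <= t%:E)%E] =
    (N `&` [set w | (tau w <= t%:E)%E]) `|`
    (~` N `&` [set w | (tau' w <= t%:E)%E]).
  apply/seteqP; split=> w /=.
    by case: ifPn; rewrite ?notin_setE ?inE => wN wt; [left|right].
  by case=> -[wN wt]; [rewrite mem_set|rewrite memNset].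
have FN := filtration_negligible t0 PN.
apply: filtrationU => //; apply: filtrationI => //; first exact: Ftau.
  exact: filtrationC.
exact: Ftau'.
Qed.

Lemma stopped_pathE X tau w (r : R) : tau w = r%:E ->
  (fun s => stopped X tau (w, s)) = stop_path (fun s => X (w, s)) r.
Proof.
move=> tauE; apply/funext => s; rewrite /stopped /stop_path /= tauE.
by rewrite -EFin_min /= minC.
Qed.

Lemma stopped_le X tau w t : (t%:E <= tau w)%E -> stopped X tau (w, t) = X (w, t).
Proof. by move=> ttau; rewrite /stopped/= (min_idPl ttau). Qed.

(** For adaptedness, min(t, tau) is F_t-measurable. Sampling A at the next grid point to its right,
    capped at t, is F_t-measurable too, and right-continuity gives the limit. *)
Lemma FV_process_stopped A tau : stopping_time F tau -> FV_process F A ->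
  FV_process F (stopped A tau).
Proof.
move=> tauP AP; split=> [t t0|w]; last first.
  have aP := FV_process_path w AP.
  have := tauP.1 w; case E : (tau w) => [r| |]// r0.
    by rewrite (stopped_pathE _ E); exact: FV_path_stop.
  have -> // : (fun t => stopped A tau (w, t)) = (fun t => A (w, t)).
  by apply/funext => t; rewrite stopped_le// E leey.
pose rho w := fine (Order.min t%:E (tau w)).
have rhoE w : (rho w)%:E = Order.min t%:E (tau w).
  rewrite /rho fineK//; move: (tauP.1 w); case: (tau w) => [r| |]// _.
    by rewrite -EFin_min.
  by rewrite (min_idPl (leey _)).
have rho0t w : 0 <= rho w <= t.
  by rewrite -!lee_fin rhoE le_min lee_fin t0 (tauP.1 w) ge_min lexx.
have mrho : measurable_fun [set: Ft t] rho.
  apply: measurable_fun_sublevel => c.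
  apply/(measurable_filtrationE hF _ t0).
  have [tc|ct] := leP t c.
    rewrite [X in F t X](_ : _ = setT).
      by apply/(measurable_filtrationE hF _ t0); exact: measurableT.
    apply/seteqP; split=> // w _ /=; rewrite (le_trans _ tc)//.
    by have /andP[] := rho0t w.
  have [c0|c0] := leP 0 c.
    rewrite [X in F t X](_ : _ = [set w | (tau w <= c%:E)%E]).
      exact: (filtration_increasing hF c0 (ltW ct)) (tauP.2 c c0).
    by apply/seteqP; split=> w /=; rewrite -lee_fin rhoE ge_min lee_fin (leNgt t c) ct.
  rewrite [X in F t X](_ : _ = set0).
    by have [] := filtration_sigma_algebra hF t0.
  apply/seteqP; split=> // w /=; have /andP[r0 _] := rho0t w.
  by move/(le_trans r0); rewrite leNgt c0.
pose h n (w : Ft t) := A (w, grid_point t n (grid_index n (rho w))).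
apply: (@measurable_fun_cvg _ (Ft t) R setT h).
  move=> n; apply: (@measurable_fun_glue R _ (Ft t) setT
    (fun i w => A (w, grid_point t n i)) (fun w => grid_index n (rho w))) => //.
    move=> k; apply: (adapted_measurable hF); first by case: AP.
      exact: grid_point_ge0.
    by rewrite /grid_point ge_min lexx.
  (* [grid_index] is positive, so its sublevel set at 0 is empty; the successor cancels the one in
     its definition. *)
  move=> [|k].
    by rewrite [X in _ `&` X](_ : _ = set0) ?setI0//; apply/seteqP; split.
  have -> : [set w | (grid_index n (rho w) <= k.+1)%N] =
      [set w | (rho w * n.+1%:R < k.+1%:R)].
    by apply/seteqP; split=> w /=; rewrite ltnS truncn_le_nat.
  rewrite setTI -[X in measurable X]setTI.
  rewrite (_ : [set w | _] = (fun w => rho w * n.+1%:R) @^-1` `]-oo, k.+1%:R[%classic).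
    apply: (measurable_funM mrho (measurable_cst _)) => //.
  by apply/seteqP; split=> w /=; rewrite in_itv.
move=> w _; apply: (@cvg_grid_point _ (fun s => A (w, s))) => //.
have /andP[r0 _] := rho0t w.
by have [/(_ _ r0)[]] := FV_process_path w AP.
Qed.

End stopping_times.

(** * Gluing predictable processes along stopping times *)

Section glued_process.
Context {R : realType} {d : measure_display} {Om : measurableType d}.
Variables (P : probability Om R) (F : R -> set (set Om)).
Hypothesis hF : usual_conditions P F.
Local Notation pT := (g_sigma_algebraType (predictable_generator F)).
Implicit Types (X H A : Om * R -> R) (t s : R) (tau : Om -> \bar R).

(** The indicator of [[[0, tau]]] is adapted and left-continuous, so the set is a generator, namely
    a preimage of 1. *)
Lemma predictable_stochastic_interval tau : stopping_time F tau ->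
  measurable (time_domain `&` [set z | (z.2%:E <= tau z.1)%E] : set pT).
Proof.
move=> tauP; apply: sub_sigma_algebra.
exists (fun z : Om * R => if (z.2%:E <= tau z.1)%E then 1 else 0).
  split=> [t t0|w t t_gt0] /=; last first.
    apply: cvg_near_cst; have [ttau|taut] := leP t%:E (tau w).
      near=> s; suff -> : (s%:E <= tau w)%E by [].
      apply: le_trans ttau; rewrite lee_fin; near: s; exact: nbhs_left_le.
    have [r taur rt] : exists2 r, tau w = r%:E & r < t.
      by move: (tauP.1 w) taut; case: (tau w) => [r| |]// _ rt; exists r.
    near=> s; rewrite taur lee_fin ifF//; apply/negbTE; rewrite -ltNge.
    by near: s; exact: nbhs_left_gt.
  have mtau : measurable
      ([set w | (t%:E <= tau w)%E] : set (g_sigma_algebraType (F t))).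
    apply/(measurable_filtrationE hF _ t0).
    rewrite (_ : [set w | _] = ~` [set w | (tau w < t%:E)%E]).
      by apply: (filtrationC hF) => //; exact: (stopping_time_lt hF).
    by apply/seteqP; split=> w /=; rewrite leNgt => /negP.
  rewrite (_ : (fun w => _) = \1_[set w | (t%:E <= tau w)%E]).
    exact: measurable_indic.
  apply/funext => w; rewrite indicE.
  by case: ifPn => h; [rewrite mem_set|rewrite memNset//; exact/negP].
exists [set 1] => //=.
rewrite -[RHS]/(_ `&` _); congr (_ `&` _); apply/seteqP; split=> z /=.
  by case: ifP => // _ /esym /eqP; rewrite oner_eq0.
by move=> ->.
Unshelve. all: by end_near. Qed.

(* The value outside the union of the [[0, T_n]] is the junk index 0. *)
Definition first_index (T_ : nat -> Om -> \bar R) (z : Om * R) : nat :=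
  if pselect (exists n, (z.2%:E <= T_ n z.1)%E) is left ex then ex_minn ex else 0.

Definition glued (T_ : nat -> Om -> \bar R) (H_ : nat -> Om * R -> R) : Om * R -> R :=
  fun z => H_ (first_index T_ z) z.

Lemma first_indexP (T_ : nat -> Om -> \bar R) n z : (z.2%:E <= T_ n z.1)%E ->
  (z.2%:E <= T_ (first_index T_ z) z.1)%E.
Proof.
move=> zn; rewrite /first_index; case: pselect => [ex|[]]; last by exists n.
by case: ex_minnP.
Qed.

Lemma glued_predictable (T_ : nat -> Om -> \bar R) (H_ : nat -> Om * R -> R) :
  (forall n, stopping_time F (T_ n)) ->
  (forall n, predictable_process F (H_ n)) -> predictable_process F (glued T_ H_).
Proof.
move=> TP HP.
have mD := predictable_time_domain.
apply: (@measurable_fun_glue R _ pT time_domain H_ (first_index T_)) => // k.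
pose E n := time_domain `&` [set z | (z.2%:E <= T_ n z.1)%E] : set pT.
have mE n : measurable (E n) by exact: predictable_stochastic_interval.
(* The second set appears because the default index 0 is also at most k. *)
rewrite (_ : _ `&` _ = \bigcup_(n in [set n | (n <= k)%N]) E n `|`
    (time_domain `\` \bigcup_n E n)).
  apply: measurableU; first exact: bigcup_measurable.
  by apply: measurableD => //; exact: bigcup_measurable.
apply/seteqP; split=> z.
  move=> [Dz]; rewrite /= /first_index; case: pselect => [ex|nex] /=.
    by case: ex_minnP => m zm _ mk; left; exists m.
  by move=> _; right; split=> // -[n _ [_ zn]]; apply: nex; exists n.
case=> [[n /= nk [Dz /= zn]]|[Dz nE]]; split=> //=; rewrite /first_index;
  case: pselect => [ex|nex] //=.
  by case: ex_minnP => m _ /(_ _ zn) /leq_trans; exact.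
by exfalso; case: ex => n zn; apply: nE; exists n.
Qed.

End glued_process.

(** * Couplings read pointwise on B *)

Section coupled_sequences.
Context {R : realType} {d : measure_display} {Om : measurableType d}.
Variables (P : probability Om R) (F : R -> set (set Om)).
Variable B : set (Om * R).
Hypothesis hB : interval_type F B.
Implicit Types (X Y H A : Om * R -> R) (t s : R) (tau : Om -> \bar R).

(** After tau both processes are frozen at their values at tau, and off B both are 0, so only the
    points of B up to tau matter. *)
Lemma coupledP X Y tau : (forall w, 0 <= tau w)%E ->
  indistinguishable P (stopped (X \_ B) tau) (stopped (Y \_ B) tau) <->
  {ae P, forall w, forall t, 0 <= t -> (t%:E <= tau w)%E -> B (w, t) ->
    X (w, t) = Y (w, t)}.
Proof.
move=> tau0; split; apply: filterS => w XY t t0.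
  move=> ttau Bwt; have := XY t t0; rewrite !stopped_le// !patchE.
  by rewrite mem_set.
rewrite /stopped /= !patchE; case: ifPn => //; rewrite inE => Bwt.
apply: XY => //; first by rewrite fine_ge0// le_min lee_fin t0 tau0.
move: (tau0 w); case: (tau w) => [r| |]//= r0.
  by rewrite -EFin_min/= lee_fin ge_min lexx orbT.
by rewrite leey.
Qed.

Lemma eq_onP X Y : eq_on P B X Y <->
  {ae P, forall w, forall t, 0 <= t -> B (w, t) -> X (w, t) = Y (w, t)}.
Proof.
split; apply: filterS => w XY t t0; last first.
  by rewrite !patchE; case: ifPn => //; rewrite inE; exact: XY.
by move=> Bwt; have := XY t t0; rewrite !patchE mem_set.
Qed.

Lemma interval_type_ge0 w t : B (w, t) -> 0 <= t.
Proof.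
by case: hB => -[[BT _]|[BT _]] _ /BT [_ /=]; rewrite in_itv/= andbT.
Qed.

Lemma interval_type_down w s t : B (w, t) -> 0 <= s <= t -> B (w, s).
Proof.
move=> Bwt /andP[s0 st]; case: hB => _ [tau [_ _ /(_ w)[_ Btau]]].
have : xsection B w t by rewrite /xsection/= inE.
suff : xsection B w t -> xsection B w s by move=> /[apply]; rewrite /xsection/= inE.
case: Btau => -> /= [t0 ttau]; split=> //.
  by apply: le_lt_trans ttau; rewrite lee_fin.
by apply: le_trans ttau; rewrite lee_fin.
Qed.

Lemma lt_debut w t : 0 <= t -> (t%:E < debut (~` B) w)%E -> B (w, t).
Proof.
move=> t0; rewrite ltNge => /negP H; apply: contrapT => nB; apply: H.
by apply: ereal_inf_lbound; exists t.
Qed.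

Lemma FCS_le_debut D X T_ (X_ : nat -> Om * R -> R) n w : FCS P F D B X T_ X_ ->
  (T_ n w <= debut (~` B) w)%E.
Proof.
move=> XT; have T_nd := FCS_increasing XT w.
have T_cvg : T_ n w @[n --> \oo] --> debut (~` B) w by exact: (FCS_cvg XT).
rewrite (cvg_unique _ T_cvg (ereal_nondecreasing_cvgn T_nd))//.
by apply: ereal_sup_ubound; exists n.
Qed.

(** The inequality is strict because [T_ n w] may equal the debut of the complement while the
    section of B is open there. This is the source of the integrals over [[0, t[] below. *)
Lemma lt_FCS D X T_ (X_ : nat -> Om * R -> R) n w t : FCS P F D B X T_ X_ -> 0 <= t ->
  (t%:E < T_ n w)%E -> B (w, t).
Proof.
move=> XT t0 tT; apply: lt_debut => //.
by rewrite (lt_le_trans tT)// (FCS_le_debut _ _ XT).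
Qed.

Lemma FCS_ae_eq D X T_ (X_ : nat -> Om * R -> R) : FCS P F D B X T_ X_ ->
  {ae P, forall w, forall n t, 0 <= t -> (t%:E <= T_ n w)%E -> B (w, t) ->
    X (w, t) = X_ n (w, t)}.
Proof.
move=> XT; apply: ae_foralln => n; apply/coupledP; last exact: (FCS_coupled XT).
exact: (FCS_stopping XT n).1.
Qed.

End coupled_sequences.

(** * Integrability on B *)

Local Opaque stieltjes_abs_integral stieltjes_integral.

Section integrability.
Context {R : realType} {d : measure_display} {Om : measurableType d}.
Variables (P : probability Om R) (F : R -> set (set Om)).
Hypothesis hF : usual_conditions P F.
Variable B : set (Om * R).
Hypothesis hB : interval_type F B.
Implicit Types (X Y H A : Om * R -> R) (t s : R) (tau : Om -> \bar R).

Lemma stopped_FCS A T_ (A_ : nat -> Om * R -> R) :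
  FCS P F (FV_process F) B A T_ A_ ->
  FCS P F (FV_process F) B A T_ (fun n => stopped (A_ n) (T_ n)).
Proof.
move=> AT; split; [exact: FCS_stopping AT|exact: FCS_increasing AT|
  exact: FCS_cvg AT|exact: FCS_cover AT| |].
  move=> n; apply: (FV_process_stopped hF); first exact: FCS_stopping AT n.
  exact: FCS_class AT n.
move=> n; apply/coupledP; first exact: (FCS_stopping AT n).1.
have /coupledP := FCS_coupled AT n.
move=> /(_ (FCS_stopping AT n).1); apply: filterS => w h t t0 tT Bwt.
by rewrite stopped_le// h.
Qed.

(** Half-open integrals suffice, since the endpoint adds only a finite mass and the stopped path has
    no variation afterwards. Where tau is infinite, the stopped path is the path of A itself. *)
Lemma stopped_integrable H A tau : predictable_process F H -> FV_process F A ->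
  stopping_time F tau ->
  {ae P, forall w, forall t, 0 <= t -> (t%:E <= tau w)%E ->
    (\int[stieltjes_measure (variation_fun (fun s => A (w, s)))]_(s in `[0%R, t[)
      `|H (w, s)|%:E < +oo)%E} ->
  stieltjes_integrable P F (stopped A tau) H.
Proof.
move=> pH AP tauP fin; split=> //; apply: filterS fin => w fin t t0.
have aP := FV_process_path w AP; have mh := predictable_path hF w pH.
have {}fin r : 0 <= r -> (r%:E <= tau w)%E ->
    (stieltjes_abs_integral (fun s => H (w, s)) (fun s => A (w, s)) r < +oo)%E.
  by move=> r0 rtau; apply: stieltjes_abs_integral_fin_left => //; exact: fin.
have := tauP.1 w; case E : (tau w) => [r| |]// r0.
  rewrite (stopped_pathE _ E).
  have rtau : (r%:E <= tau w)%E by rewrite E.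
  apply: le_lt_trans (fin r r0 rtau).
  exact: stieltjes_abs_integral_stop.
have -> : (fun s => stopped A tau (w, s)) = (fun s => A (w, s)).
  by apply/funext => s; rewrite stopped_le// E leey.
by apply: fin => //; rewrite E leey.
Qed.

Lemma local_predictable_coupled H T_ (H_ : nat -> Om * R -> R) :
  FCS P F (predictable_process F) B H T_ H_ ->
  coupled_predictable P F B H (glued T_ H_).
Proof.
move=> HT; split.
  by apply: (glued_predictable hF); [exact: FCS_stopping HT|exact: FCS_class HT].
apply/eq_onP; apply: filterS (FCS_ae_eq HT) => w h t t0 Bwt.
have [n _ [_ /= tn]] := FCS_cover HT Bwt.
rewrite /glued; apply: h => //.
exact: (first_indexP (z := (w, t)) tn).
Qed.

(** The times [T_] serve for the integral as well: B is closed under going back in time, so at a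
    point of B up to [T_ n] the pairs (H, A) and (H', A^(n)) agree on all of [[0, t]]. *)
Lemma local_class_pathwise_integral H A H' T_ (A_ : nat -> Om * R -> R) :
  coupled_predictable P F B H H' -> FCS P F (FV_process F) B A T_ A_ ->
  (forall n, stieltjes_integrable P F (A_ n) H') ->
  local_class P F (FV_process F) B (pathwise_integral H A).
Proof.
move=> [pH /eq_onP HH'] AT HA.
(* Quantifying over n inside Q yields one null set for the whole sequence. *)
pose Q w := forall n t, 0 <= t -> (stieltjes_abs_integral
  (fun s => H' (w, s)) (fun s => A_ n (w, s)) t < +oo)%E.
have aeQ : {ae P, forall w, Q w} by apply: ae_foralln => n; have [] := HA n.
pose N := ~` [set w | Q w].
have PN : P.-negligible N by exact: aeQ.
(* Since F 0 contains the negligible sets, redefining the integral as 0 on N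
   keeps it adapted. *)
pose L n (z : Om * R) := pathwise_integral H' (A_ n) z * \1_(~` N) z.1.
exists T_, L; split; [exact: FCS_stopping AT|exact: FCS_increasing AT|
  exact: FCS_cvg AT|exact: FCS_cover AT| |].
- move=> n; have An : FV_process F (A_ n) by exact: FCS_class AT n.
  split=> [t t0|w].
    apply: measurable_funM; first exact: (measurable_stieltjes_integral hF).
    apply: measurable_indic; apply/(measurable_filtrationE hF _ t0).
    by apply: (filtrationC hF) => //; exact: (filtration_negligible hF).
  rewrite -/(FV_path _) /L /=.
  have aP := FV_process_path w An; have mh := predictable_path hF w pH.
  have [wN|wN] := boolP (w \in ~` N); last first.
    apply: (@eq_FV_path _ (cst 0)).
      by move=> t _; rewrite indicE (negbTE wN) mulr0.
    split=> t t0; first by split=> [|_]; [exact: cvg_cst|exact: is_cvg_cst].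
    by apply: nondecreasing_bounded_variation => x y _ _ _ /=.
  have Qw : Q w by move: wN; rewrite inE /N setCK.
  apply: eq_FV_path (FV_path_stieltjes_integral mh aP (Qw n)) => t t0.
  by rewrite indicE wN mulr1.
- move=> n; apply/coupledP; first exact: (FCS_stopping AT n).1.
  move: aeQ (FCS_ae_eq AT) HH'; apply: filterS3 => w Qw AAn HH't t t0 tT Bwt.
  have wN : w \in ~` N by rewrite inE /N setCK.
  rewrite /L /= indicE wN mulr1 /pathwise_integral /=.
  apply: eq_stieltjes_integral => // s /andP[s0 st].
    by apply: HH't => //; apply: (interval_type_down hB Bwt); rewrite s0.
  apply: AAn => //; last by apply: (interval_type_down hB Bwt); rewrite s0.
  by apply: le_trans tT; rewrite lee_fin.
Qed.

Lemma coupled_B_integrable H A H' T_ (A_ : nat -> Om * R -> R) :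
  local_class P F (predictable_process F) B H ->
  coupled_predictable P F B H H' -> FCS P F (FV_process F) B A T_ A_ ->
  (forall n, stieltjes_integrable P F (A_ n) H') ->
  B_stieltjes_integrable P F B A H.
Proof.
move=> hH cH AT HA; split=> //; last exact: local_class_pathwise_integral cH AT HA.
have aeQ : {ae P, forall w, forall n t, 0 <= t -> (stieltjes_abs_integral
    (fun s => H' (w, s)) (fun s => A_ n (w, s)) t < +oo)%E}.
  by apply: ae_foralln => n; have [] := HA n.
case: cH => _ /eq_onP HH'.
move: aeQ (FCS_ae_eq AT) HH'; apply: filterS3 => w Qw AAn HH't t Bwt.
have [n _ [/= t0 tn]] := FCS_cover AT Bwt.
apply: le_lt_trans (Qw n t t0); rewrite le_eqVlt; apply/orP; left; apply/eqP.
apply: eq_stieltjes_abs_integral => // s /andP[s0 st].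
  by apply: HH't => //; apply: (interval_type_down hB Bwt); rewrite s0.
apply: AAn => //; last by apply: (interval_type_down hB Bwt); rewrite s0.
by apply: le_trans tn; rewrite lee_fin.
Qed.

(** Strictly before [T_ n] the glued process equals H, hence [H_ n], almost surely, and inherits its
    finite integral. From [T_ n] on the two may differ, which is why the integrator is stopped. *)
Lemma coupled_sequences_integrable H A T_ (H_ A_ : nat -> Om * R -> R) :
  FCS P F (predictable_process F) B H T_ H_ ->
  FCS P F (FV_process F) B A T_ A_ ->
  (forall n, stieltjes_integrable P F (A_ n) (H_ n)) ->
  forall n, stieltjes_integrable P F (stopped (A_ n) (T_ n)) (glued T_ H_).
Proof.
move=> HT AT HA n.
have [pH /eq_onP HG] := local_predictable_coupled HT.
have An : FV_process F (A_ n) by exact: FCS_class AT n.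
apply: stopped_integrable => //; first exact: FCS_stopping AT n.
have [pHn fin] := HA n.
move: fin (FCS_ae_eq HT) HG; apply: filterS3 => w fin HHn HGt t t0 tT.
have aP := FV_process_path w An; have mh := predictable_path hF w pHn.
apply: le_lt_trans (fin t t0).
rewrite (stieltjes_abs_integralE _ aP t0).
set mu := stieltjes_measure _.
apply: (@le_trans _ _ (\int[mu]_(s in `[0%R, t[) `|H_ n (w, s)|%:E)%E).
  rewrite le_eqVlt; apply/orP; left; apply/eqP; apply: eq_integral => s.
  rewrite inE/= in_itv/= => /andP[s0 st].
  have sT : (s%:E < T_ n w)%E by rewrite (lt_le_trans _ tT)// lte_fin.
  have Bws : B (w, s) by exact: lt_FCS AT s0 sT.
  by rewrite -HGt// (HHn n)// ltW.
apply: ge0_subset_integral => //.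
  apply/measurable_EFinP; apply: measurableT_comp => //.
  apply: measurable_funS mh; first exact: measurableTypeR_itv.
  by move=> x /=; rewrite !in_itv/= andbT => /andP[].
by move=> x /=; rewrite !in_itv/= => /andP[-> /ltW].
Qed.

Lemma B_integrable_coupled H A T_ (A_ : nat -> Om * R -> R) H' :
  coupled_predictable P F B H H' ->
  FCS P F (FV_process F) B A T_ A_ ->
  {ae P, forall w, forall t, B (w, t) ->
    (stieltjes_abs_integral (fun s => H (w, s)) (fun s => A (w, s)) t < +oo)%E} ->
  exists2 S_ : nat -> Om -> \bar R, FCS P F (FV_process F) B A S_ A_ &
    forall n, stieltjes_integrable P F (stopped (A_ n) (S_ n)) H'.
Proof.
move=> [pH /eq_onP HH'] AT fin.
pose V n t w := stieltjes_abs_integral (fun s => H' (w, s)) (fun s => A_ n (w, s)) t.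
have An n : FV_process F (A_ n) by exact: FCS_class AT n.
have V_nd n s t w : 0 <= s -> s <= t -> (V n s w <= V n t w)%E.
  move=> s0 st; apply: stieltjes_abs_integral_nd => //.
    exact: (predictable_path hF).
  exact: FV_process_path.
(* The value v is the same for all n with t <= [T_ n w]. This comparison of different V^n underlies
   both the monotonicity of the new times and their covering of B. *)
pose Q w := forall t, B (w, t) -> exists v : R, forall n,
  (t%:E <= T_ n w)%E -> V n t w = v%:E.
have aeQ : {ae P, forall w, Q w}.
  move: fin (FCS_ae_eq AT) HH'; apply: filterS3 => w fin AAn HH't t Bwt.
  have t0 := interval_type_ge0 hB Bwt.
  have v0 : (0 <= stieltjes_abs_integral (fun s => H (w, s)) (fun s => A (w, s)) t)%E.
    exact: stieltjes_abs_integral_ge0.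
  exists (fine (stieltjes_abs_integral (fun s => H (w, s)) (fun s => A (w, s)) t)).
  move=> n tn; rewrite fineK; last by rewrite ge0_fin_numE// fin.
  apply/esym; apply: eq_stieltjes_abs_integral => // s /andP[s0 st].
    by apply: HH't => //; apply: (interval_type_down hB Bwt); rewrite s0.
  apply: AAn => //; last by apply: (interval_type_down hB Bwt); rewrite s0.
  by apply: le_trans tn; rewrite lee_fin.
pose N := ~` [set w | Q w].
have PN : P.-negligible N by exact: aeQ.
have NQ w : w \notin N -> Q w by rewrite notin_setE => /contrapT.
pose sigma n := hitting_time (V n) n%:R%:E.
have lt_sigma n w u : 0 <= u -> (u%:E < sigma n w)%E -> (V n u w < n%:R%:E)%E.
  exact: lt_hitting_time.
have le_sigma n w u : (forall s, 0 <= s -> s < u -> (V n s w < n%:R%:E)%E) ->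
    (u%:E <= sigma n w)%E.
  exact: le_hitting_time.
have sigma_lt n w r : (sigma n w < r)%E ->
    exists2 u : R, 0 <= u /\ (n%:R%:E <= V n u w)%E & (u%:E < r)%E.
  by move=> /ereal_inf_lt[_ [u uP <-] ur]; exists u.
have sigmaP n : stopping_time F (sigma n).
  apply: (hitting_time_stopping hF); first by move=> s t w; exact: V_nd.
  by move=> t t0; exact: (measurable_stieltjes_abs_integral hF).
clearbody sigma.
(* On N monotonicity and convergence may fail for the hitting times, but FCSs
   require them for every w. *)
pose S_ n w := if w \in N then T_ n w else Order.min (T_ n w) (sigma n w).
have ST n w : (S_ n w <= T_ n w)%E.
  by rewrite /S_; case: ifP => // _; rewrite ge_min lexx.
have SP n : stopping_time F (S_ n).
  apply: (stopping_time_negligible hF PN); first exact: FCS_stopping AT n.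
  by apply: (stopping_time_min hF) => //; exact: FCS_stopping AT n.
have T_nd w : {homo T_ ^~ w : m n / (m <= n)%N >-> (m <= n)%E}.
  exact: FCS_increasing AT w.
have S_nd w : {homo S_ ^~ w : m n / (m <= n)%N >-> (m <= n)%E}.
  move=> m n mn; rewrite /S_; case: ifPn => [_|wN]; first exact: T_nd.
  rewrite le_min; apply/andP; split.
    by apply: (le_trans _ (T_nd w m n mn)); rewrite ge_min lexx.
  (* If [sigma n w] < r, some u < r has V^n_u >= n. As u < [T_ m w], V^m_u has the same value, while
     u < [sigma m w] forces V^m_u < m <= n. *)
  set r := Order.min _ _; have [rs|sr] := leP r (sigma n w); first by [].
  have [u [u0 nu] ur] := sigma_lt n w r sr.
  move: ur; rewrite lt_min => /andP[uT us].
  have [v vE] := NQ w wN u (lt_FCS AT u0 uT).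
  have := lt_sigma m w u u0 us.
  have unT : (u%:E <= T_ n w)%E by rewrite (le_trans (ltW uT))// T_nd.
  rewrite (vE m (ltW uT)) -(vE n unT) => /(le_lt_trans nu).
  by rewrite lte_fin ltr_nat ltnNge mn.
have SB w t : B (w, t) -> exists n, (t%:E <= S_ n w)%E.
  move=> Bwt; have [m _ [/= t0 tm]] := FCS_cover AT Bwt.
  have [wN|wN] := boolP (w \in N); first by exists m; rewrite /S_ wN.
  have [v vE] := NQ w wN t Bwt.
  (* The index m makes [T_ n] reach t; the other one exceeds v = V^n_t, so level n is not hit before
     t. *)
  exists (maxn m (Num.trunc v).+1); set n := maxn _ _; rewrite /S_ (negbTE wN).
  have tn : (t%:E <= T_ n w)%E by rewrite (le_trans tm)// T_nd// leq_maxl.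
  rewrite le_min tn/=; apply: le_sigma => s s0 st.
  apply: (le_lt_trans (V_nd n s t w s0 (ltW st))).
  rewrite (vE n tn) lte_fin (@lt_le_trans _ _ (Num.trunc v).+1%:R)//.
    by rewrite -truncn_le_nat.
  by rewrite ler_nat leq_maxr.
exists S_; last first.
  move=> n; apply: stopped_integrable => //.
  apply: filterS aeQ => w Qw t t0 tS.
  have wN : w \notin N by rewrite notin_setE; apply.
  apply: (@le_lt_trans _ _ n%:R%:E); last by rewrite ltry.
  apply: le_stieltjes_abs_integral_left => //.
  - exact: (predictable_path hF).
  - exact: FV_process_path.
  - move=> u u0 ut; apply/ltW; apply: (lt_sigma n w u u0).
    apply: (@lt_le_trans _ _ t%:E); first by rewrite lte_fin.
    by apply: (le_trans tS); rewrite /S_ (negbTE wN) ge_min lexx orbT.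
split=> //.
- move=> w; rewrite -(_ : ereal_sup (range (S_ ^~ w)) = debut (~` B) w).
    exact: ereal_nondecreasing_cvgn.
  apply/eqP; rewrite eq_le; apply/andP; split.
    apply: ge_ereal_sup => _ [n _ <-]; rewrite (le_trans (ST n w))//.
    exact: FCS_le_debut AT.
  (* A time strictly between the supremum and the debut would belong to B, hence lie below some
     [S_ n w]. *)
  rewrite leNgt; apply/negP => Slt.
  have S0 : (0 <= ereal_sup (range (S_ ^~ w)))%E.
    by apply: le_trans (ereal_sup_ubound _); [exact: (SP 0).1 w|exists 0].
  have [t St tT] : exists2 t : R, (ereal_sup (range (S_ ^~ w)) < t%:E)%E &
      (t%:E < debut (~` B) w)%E.
    move: S0 Slt; case: (ereal_sup _) => [x| |]// _; last by rewrite ltNge leey.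
    case: (debut (~` B) w) => [y| |]//; last first.
      by move=> _; exists (x + 1); rewrite ?ltry// lte_fin ltrDl.
    rewrite lte_fin => xy; have [xm my] := midf_lt xy.
    by exists ((x + y) / 2); rewrite lte_fin.
  have t0 : 0 <= t by rewrite -lee_fin (le_trans S0)// ltW.
  have [n tn] := SB w t (lt_debut t0 tT).
  move: St; rewrite ltNge; apply/negP; rewrite negbK (le_trans tn)//.
  by apply: ereal_sup_ubound; exists n.
- by move=> [w t] Bwt; have [n tn] := SB w t Bwt; exists n => //; split=> //;
    exact: (interval_type_ge0 hB Bwt).
- move=> n; apply/coupledP; first exact: (SP n).1.
  apply: filterS (FCS_ae_eq AT) => w AAn t t0 tS Bwt.
  by apply: AAn => //; exact: le_trans (ST n w).
Qed.

End integrability.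

Theorem theorem3p2 (R : realType) (d : measure_display) (Om : measurableType d)
    (P : probability Om R) (F : R -> set (set Om))
    (hF : usual_conditions P F)
    (B : set (Om * R)) (hB : interval_type F B)
    (H A : Om * R -> R)
    (hH : local_class P F (predictable_process F) B H)
    (hA : local_class P F (FV_process F) B A) :
  let A1 := B_stieltjes_integrable P F B A H in
  let A2 := exists (H' : Om * R -> R) (T_ : nat -> Om -> \bar R)
                   (A_ : nat -> Om * R -> R),
    [/\ coupled_predictable P F B H H',
        FCS P F (FV_process F) B A T_ A_ &
        forall n, stieltjes_integrable P F (A_ n) H'] in
  let A3 := exists (T_ : nat -> Om -> \bar R) (H_ A_ : nat -> Om * R -> R),
    [/\ FCS P F (predictable_process F) B H T_ H_,
        FCS P F (FV_process F) B A T_ A_ &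
        forall n, stieltjes_integrable P F (A_ n) (H_ n)] in
  (A1 <-> A2) /\ (A2 <-> A3).
Proof.
move=> A1 A2 A3; split; split.
- move=> [_ fin _]; have [S_ [H_ /(local_predictable_coupled hF) cH]] := hH.
  have [T_ [A_ AT]] := hA.
  have [U_ AU int] := B_integrable_coupled hF hB cH AT fin.
  by exists (glued S_ H_), U_, (fun n => stopped (A_ n) (U_ n)); split=> //;
    exact: stopped_FCS.
- by move=> [H' [T_ [A_ [cH AT int]]]]; exact: coupled_B_integrable cH AT int.
- move=> [H' [T_ [A_ [[pH /eq_onP HH'] AT int]]]].
  (* H' agrees with H on all of B, so the constant sequence is coupled to H along the times already
     given for A. *)
  exists T_, (fun=> H'), A_; split=> //; case: AT => T_stop T_nd T_cvg T_cover _ _.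
  split=> // n; apply/coupledP; first exact: (T_stop n).1.
  by apply: filterS HH' => w HH' t t0 _; exact: HH'.
- move=> [T_ [H_ [A_ [HT AT int]]]].
  exists (glued T_ H_), T_, (fun n => stopped (A_ n) (T_ n)); split.
  + exact: (local_predictable_coupled hF HT).
  + exact: stopped_FCS.
  + exact: coupled_sequences_integrable HT AT int.
Qed.
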